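(* Let $\mathcal{X}=\mathbb{R}^d$ and let $f(x)=\mathbb{E}[F(x;\omega)]$, where $F$ satisfies the regularity assumptions (R1)–(R3) given in the context. Let $(X_n)_{n\ge 0}$ be generated by distributed asynchronous stochastic gradient descent (DASGD): $X_0\in\mathbb{R}^d$ and $$X_{n+1}=X_n-\alpha_{n+1}\nabla F(X_{s(n)};\omega_{n+1}),\qquad n\ge 0,$$ where the step-sizes $(\alpha_n)$ and the delays $(d_n)$ induced by $s$ satisfy one of the four delay/step-size conditions (D1)–(D4) given in the context. If $\inf_{x\in\mathcal{X}} f(x)>-\infty$, then $$\lim_{n\to\infty}\mathbb{E}\big[\|\nabla f(X_n)\|_2^2\big]=0 .$$
   Context: Setting. $(\Omega,\mathcal{F},\mathbb{P})$ is a complete probability space, $\mathcal{X}=\mathbb{R}^d$, $F:\mathcal{X}\times\Omega\to\mathbb{R}$ is a random function ($F(x;\cdot)$ is measurable for each $x$), and $f(x)=\mathbb{E}[F(x;\omega)]=\int_\Omega F(x;\omega)\,d\mathbb{P}(\omega)$ is a real-valued function on $\mathcal X$. $\nabla F(x;\omega)$ denotes the gradient in $x$ only. Regularity assumptions. (R1) $F(x;\omega)$ is differentiable in $x$ for $\mathbb{P}$-almost all $\omega$. (R2) $\sup_{x\in\mathcal{X}}\mathbb{E}[\|\nabla F(x;\omega)\|_2^2]<\infty$. (R3) $x\mapsto \mathbb{E}[\nabla F(x;\omega)]$ is Lipschitz on $\mathcal{X}$. Under these assumptions $f$ is differentiable with $\nabla f(x)=\mathbb{E}[\nabla F(x;\omega)]$.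 Samples. $\omega_1,\omega_2,\dots$ are i.i.d. samples from $\mathbb{P}$. Delays. $s:\{0,1,2,\dots\}\to\{0,1,2,\dots\}$ is a function with $s(n)\le n$; $s(n)$ is the iteration from which the gradient received at iteration $n$ originated ($s$ need not be one-to-one). The delay of a gradient requested at iteration $k$ and received at iteration $n$ (so $s(n)=k$) is $n-s(n)$; put $d_k:=\sup\{n-k: s(n)=k\}$ ($d_k:=0$ if there is no such $n$), which is required to be finite. Delay/step-size conditions (step-sizes $\alpha_n>0$); one of the following holds: (D1) Bounded delays: $\sup_n d_n\le D$ for some positive number $D$, and $\sum_{n=1}^\infty\alpha_n^2<\infty$, $\sum_{n=1}^\infty\alpha_n=\infty$. (D2) Sublinearly growing delays: $d_n=O(n^p)$ for some $0<p<1$, and $\alpha_n\propto 1/n$. (D3) Linearly growing delays: $d_n=O(n)$, and $\alpha_n\propto 1/(n\log n)$. (D4) Polynomially growing delays: $d_n=O(n^q)$ for some $q\ge 1$, and $\alpha_n\propto 1/(n\log n\log\log n)$. Here $\alpha_n\propto g(n)$ means that there is a constant $c>0$ with $\alpha_n=c\,g(n)$ for all $n$ large enough that $g(n)$ is defined and positive (the finitely many other step-sizes being arbitrary positive numbers). *)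

(* Defs.v *)
From HB Require Import structures.
From mathcomp Require Import all_boot all_order all_algebra finmap.
From mathcomp Require Import all_classical all_reals all_analysis.

Set Implicit Arguments.
Unset Strict Implicit.
Unset Printing Implicit Defensive.
Import Order.TTheory GRing.Theory Num.Theory.
Import numFieldNormedType.Exports.

Local Open Scope classical_set_scope.
Local Open Scope ring_scope.

(* The canonical norm on ['rV[R]_d] is the maximum norm, hence this explicit
   Euclidean norm. *)
Definition norm2 (R : realType) (d : nat) (v : 'rV[R]_d) : R :=
  Num.sqrt (\sum_(i < d) v 0 i ^+ 2).

(* The vector of partial derivatives; it is junk where [g] is not
   differentiable. *)
Definition gradient (R : realType) (d : nat) (g : 'rV[R]_d -> R)
    (x : 'rV[R]_d) : 'rV[R]_d :=
  \row_(i < d) 'D_(delta_mx 0 i) g x.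

Section StochasticObjective.
Context (R : realType) (d : nat) (dT : measure_display)
  (T : measurableType dT) (P : probability T R) (F : 'rV[R]_d -> T -> R).

Definition gradF (x : 'rV[R]_d) (w : T) : 'rV[R]_d := gradient (F ^~ w) x.

Definition objective (x : 'rV[R]_d) : R := fine 'E_P[F x].

Definition mean_gradF (x : 'rV[R]_d) : 'rV[R]_d :=
  \row_(i < d) fine 'E_P[fun w => gradF x w 0 i].

(* The exceptional null set does not depend on [x]. *)
Definition ae_differentiable : Prop :=
  {ae P, forall w, forall x : 'rV[R]_d, differentiable (F ^~ w) x}.

Definition bounded_second_moment : Prop :=
  (ereal_sup (range (fun x : 'rV[R]_d => 'E_P[(fun w => norm2 (gradF x w) ^+ 2)%R]))
    < +oo)%E.

Definition lipschitz_mean_gradient : Prop :=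
  exists L : R, forall x y : 'rV[R]_d,
    norm2 (mean_gradF x - mean_gradF y) <= L * norm2 (x - y).

End StochasticObjective.

(* [W] is a sequence of mutually independent random elements of [T], each with
   law [P], defined on some probability space [(T', P')]. *)
Definition iid_samples (R : realType) (dT dT' : measure_display)
    (T : measurableType dT) (P : probability T R)
    (T' : measurableType dT') (P' : probability T' R)
    (W : nat -> {RV P' >-> T}) : Prop :=
  (forall n (A : set T), measurable A -> distribution P' (W n) A = P A) /\
  (forall (J : {fset nat}) (A : nat -> set T),
     (forall i, measurable (A i)) ->
     P' (\bigcap_(i in [set` J]) (W i @^-1` A i)) =
       (\prod_(i <- J) P' (W i @^-1` A i))%E).

Definition delay_set (R : realType) (s : nat -> nat) (k : nat) : set R :=
  [set (n - k)%N%:R | n in [set n | s n = k]].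

(* The supremum of the empty set is 0 in the library, so that [delay s k = 0]
   if no [n] satisfies [s n = k]. The library's [sup] is also 0 on unbounded
   sets: [delay] is meaningful only under [finite_delays]. *)
Definition delay (R : realType) (s : nat -> nat) (k : nat) : R :=
  sup (delay_set s k).

Definition finite_delays (R : realType) (s : nat -> nat) : Prop :=
  forall k, has_ubound (@delay_set R s k).

(* The division and [ln] are total, with [x / 0 = 0] and [ln x = 0] for
   [x <= 0]. For the three functions [g] used below, [g n] is thus positive
   exactly when it is defined and positive in the usual sense, i.e. for [n]
   at least 1, 2 and 3 respectively. *)
Definition proportional (R : realType) (a g : nat -> R) : Prop :=
  exists2 c : R, 0 < c & forall n, 0 < g n -> a n = c * g n.

Section DelayStepConditions.
Context (R : realType) (s : nat -> nat) (a : nat -> R).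

Definition bounded_delays : Prop :=
  [/\ exists2 D : R, 0 < D & forall n, delay R s n <= D,
      (\sum_(1 <= n <oo) (a n ^+ 2)%:E < +oo)%E
    & (\sum_(1 <= n <oo) (a n)%:E = +oo)%E].

Definition sublinear_delays : Prop :=
  (exists p : R, [/\ 0 < p, p < 1
     & delay R s =O_\oo (fun n : nat => n%:R `^ p)]) /\
  proportional a (fun n => 1 / n%:R).

Definition linear_delays : Prop :=
  delay R s =O_\oo (fun n : nat => n%:R : R) /\
  proportional a (fun n => 1 / (n%:R * ln n%:R)).

Definition polynomial_delays : Prop :=
  (exists2 q : R, 1 <= q & delay R s =O_\oo (fun n : nat => n%:R `^ q)) /\
  proportional a (fun n => 1 / (n%:R * ln n%:R * ln (ln n%:R))).

Definition delay_step_condition : Prop :=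
  bounded_delays \/ sublinear_delays \/ linear_delays \/ polynomial_delays.

End DelayStepConditions.

(* [W n] stands for the sample $\omega_{n+1}$: the samples are numbered from 0,
   whereas the step sizes [a] are numbered from 1 ([a 0] is irrelevant). *)
Definition dasgd (R : realType) (d : nat) (dT dT' : measure_display)
    (T : measurableType dT) (T' : measurableType dT')
    (F : 'rV[R]_d -> T -> R) (s : nat -> nat) (a : nat -> R)
    (W : nat -> T' -> T) (x0 : 'rV[R]_d) (X : nat -> T' -> 'rV[R]_d) : Prop :=
  (forall w, X 0%N w = x0) /\
  (forall n w, X n.+1 w = X n w - a n.+1 *: gradF F (X (s n) w) (W n w)).

(* Main.v *)
Require Import Defs.
From HB Require Import structures.
From mathcomp Require Import all_boot all_order all_algebra finmap.
From mathcomp Require Import all_classical all_reals all_analysis.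
From mathcomp Require Import measurable_realfun ring lra.

Set Implicit Arguments.
Unset Strict Implicit.
Unset Printing Implicit Defensive.
Import Order.TTheory GRing.Theory Num.Theory.
Import numFieldNormedType.Exports.

Local Open Scope classical_set_scope.
Local Open Scope ring_scope.

(** Put [u n = n], [ln n] or [ln (ln n)] respectively in the cases (D2), (D3),
    (D4): then the step sizes are comparable to the increments of [ln (u n)],
    and the delay bound says that [ln (u n) - ln (u (s n))] is
    [O(u (s n) ^ - b)] for some [b > 0]. Hence the steps have infinite sum and
    summable squares, and [a_(k+1) * \sum_(s k <= r < k) a_(r+1)] is summable;
    in case (D1) the latter sum is controlled by that of the squares.

    Every difference quotient of [F] along a segment is bounded in [L^2], since
    [|h b - h a| <= \int |h'|] for every everywhere differentiable [h]
    (Vitali-Caratheodory) and since the second moment of the gradient is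
    bounded; bounded second moments allow to exchange mean and limit, so
    [grad f = E (grad F)] is bounded and Lipschitz. A Taylor estimate for
    [f (X_(k+1))], in which the fresh sample is integrated out by Fubini over
    the sigma-algebra of the past, gives
    [a_(k+1) y_k <= E f(X_k) - E f(X_(k+1)) + summable] for
    [y_k = E |grad f(X_k)|^2]. As [|y_(k+1) - y_k| = O(a_(k+1))], the increments
    of [y_k ^ 2] are summable as well, so that [y_k] converges, necessarily to
    [0].

    The integrands of the statement are measurable only off a null set; [F] and
    [X] are first modified on null sets so that [F] is differentiable for every
    sample. *)

(** * Differentiable functions and the integral of their derivative *)

(** Real induction: the supremum [c] of the [x] with [Q a x] is attained by the left half of the
    local hypothesis, and the right half pushes beyond it if [c < b]. The radius [e] may depend on
    the point. *)
Lemma local_to_global (R : realType) (Q : R -> R -> Prop) (a b : R) :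
  a <= b ->
  (forall x y z, a <= x -> x <= y -> y <= z -> z <= b -> Q x y -> Q y z -> Q x z) ->
  (forall x, a <= x <= b -> exists2 e : R, 0 < e &
     (forall y, a <= y -> x - e < y -> y <= x -> Q y x) /\
     (forall y, y <= b -> y < x + e -> x <= y -> Q x y)) ->
  Q a b.
Proof.
move=> ab Qtrans Qloc; pose S := [set x | a <= x <= b /\ Q a x].
have Sa : S a.
  split; first by rewrite lexx ab.
  have [|e e0 [_ ]] := Qloc a; first by rewrite lexx ab.
  by apply; rewrite ?ltrDl.
have Sub : ubound S b by move=> x [/andP[]].
have hS : has_sup S by split; [exists a | exists b].
pose c := sup S.
have ac : a <= c by apply: ub_le_sup => //; exists b.
have cb : c <= b by apply: ge_sup => //; exists a.
have [|e e0 [Ql Qr]] := Qloc c; first by rewrite ac cb.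
have [x [/andP[ax xb] Qax] cex] := sup_adherent e0 hS.
have xc : x <= c by apply: ub_le_sup => //; [exists b | split; rewrite ?ax].
have Qac : Q a c by apply: (Qtrans a x c) => //; apply: Ql.
have [bce|cb'] := leP b (c + e / 2).
  by apply: (Qtrans a c b) => //; apply: Qr => //; lra.
have : S (c + e / 2).
  split; first by apply/andP; split; lra.
  by apply: (Qtrans a c) => //; [lra|exact: ltW|apply: Qr; lra].
by move/(ub_le_sup (ex_intro _ b Sub)); rewrite -/c; lra.
Qed.

Lemma is_derive_local_bound (R : realType) (h : R -> R) (x l c : R) :
  is_derive x 1 h l -> `|l| < c ->
  exists2 e : R, 0 < e & forall y, `|y - x| < e -> `|h y - h x| <= c * `|y - x|.
Proof.
move=> [dh <-] lc.
have : \forall t \near (0 : R)^', `|t^-1 *: ((h \o shift x) t%:A - h x)| < c.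
  by have /cvgr_norm_lt := dh; apply; exact: lc.
rewrite /= => /nbhs_ballP[e /= e0 he].
exists e => // y yx; have [->|yneq] := eqVneq y x.
  by rewrite !subrr normr0 mulr0.
have yx0 : y - x != 0 by rewrite subr_eq0.
have := he (y - x); rewrite /ball/= sub0r normrN => /(_ yx yx0).
rewrite /= [_%:A]mulr1 subrK normrM normfV => hc.
by rewrite -ler_pdivrMr ?normr_gt0// mulrC ltW.
Qed.

Lemma integral_series_indic (d : measure_display) (T : measurableType d)
    (R : realType) (mu : {measure set T -> \bar R}) (D : set T)
    (c : nat -> R) (U : nat -> set T) :
  measurable D -> (forall k, measurable (U k)) -> (forall k, 0 <= c k) ->
  (\int[mu]_(x in D) (\sum_(k <oo) (c k)%:E * (\1_(U k) x)%:E) =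
   \sum_(k <oo) (c k)%:E * mu (U k `&` D))%E.
Proof.
move=> mD mU c0.
have mi k : measurable_fun D (fun x => (\1_(U k) x : R)%:E).
  by apply/measurable_EFinP; exact: measurable_indic.
rewrite integral_nneseries//.
- apply: eq_eseriesr => k _.
  by rewrite ge0_integralZl// ?lee_fin// integral_indic.
- by move=> k; exact: measurable_funeM.
- by move=> k x _; rewrite mule_ge0 ?lee_fin.
Qed.

Lemma cst_le_integral (d : measure_display) (T : measurableType d)
    (R : realType) (mu : {measure set T -> \bar R}) (D : set T)
    (c : R) (f : T -> \bar R) :
  measurable D -> measurable_fun D f -> 0 <= c ->
  (forall x, D x -> (c%:E <= f x)%E) ->
  (c%:E * mu D <= \int[mu]_(x in D) f x)%E.
Proof.
by move=> mD mf c0 cf; rewrite -integral_cst//; apply: ge0_le_integral.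
Qed.

(* Vitali-Caratheodory: with [E k] the set where [|dh|] lies in
   [[k * e, k.+1 * e[] and [U k] an open set slightly larger than [E k], the
   lower semicontinuous function [\sum_k k.+1 * e * \1_(U k)] dominates
   [|dh|] near each point, hence controls the increments of [h] locally. *)
Lemma le_integral_derive (R : realType) (h dh : R -> R) (a b : R) :
  a <= b -> (forall x : R, is_derive x 1 h (dh x)) -> measurable_fun setT dh ->
  (`|h b - h a|%:E <= \int[lebesgue_measure]_(x in `[a, b]) `|dh x|%:E)%E.
Proof.
move=> ab hdh mdh; apply/lee_addgt0Pr => eps eps0.
set mu := lebesgue_measure; set D := `[a, b]%classic.
have mD : measurable D by exact: measurable_itv.
have muD : mu D = (b - a)%:E.
  rewrite /mu lebesgue_measure_itv/= lte_fin lt_neqAle ab andbT; case: eqVneq => [->|//].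
  by rewrite subrr.
(* Two errors add up to [eps]: rounding [|dh|] up to a multiple of [e] costs at most [e * (b - a)],
   and enlarging the sets [E k] costs [e] in all. *)
pose e := eps / (b - a + 1).
have e0 : 0 < e by rewrite divr_gt0//; lra.
pose c k : R := k.+1%:R * e.
have c0 k : 0 < c k by rewrite mulr_gt0.
pose E k := D `&` [set x | k%:R * e <= `|dh x| < k.+1%:R * e].
have mE k : measurable (E k).
  apply: measurableI => //.
  rewrite (_ : [set x | _] = (fun x => `|dh x|) @^-1` `[k%:R * e, k.+1%:R * e[).
    rewrite -[X in measurable X]setTI.
    by apply: (measurableT_comp (f := @Num.norm R R)) => //; exact: mdh.
  by apply/seteqP; split => x /=; rewrite in_itv.
have tE : trivIset setT E.
  apply/trivIsetP => i j _ _; wlog ij : i j / (i < j)%N.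
    move=> H; case: (ltngtP i j) => // ij _.
      by apply: H => //; rewrite ltn_eqF.
    by rewrite setIC; apply: H => //; rewrite ltn_eqF.
  move=> _; apply/seteqP; split => // x [[_ /= /andP[_ x1]] [_ /= /andP[x2 _]]].
  have : i.+1%:R * e <= j%:R * e by rewrite ler_pM2r// ler_nat.
  by lra.
have UE : D = \bigcup_k E k.
  apply/seteqP; split => [x Dx|x [k _ []]//].
  exists (Num.truncn (`|dh x| / e)) => //; split => //=.
  have /Num.Theory.truncn_itv : 0 <= `|dh x| / e by rewrite divr_ge0// ltW.
  by rewrite ler_pdivlMr// ltr_pdivrMr.
have muE k : (mu (E k) < +oo)%E.
  apply: (@le_lt_trans _ _ (mu D)); last by rewrite muD ltry.
  by apply: le_measure; rewrite ?inE; [exact: mE|exact: mD|exact: subIsetl].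
(* Weighted by [c k], the excess of [U k] over [E k] contributes at most [e / 2 ^ k.+1], a series of
   sum [e]. *)
pose d k := e / (2 ^ k.+1)%:R / c k.
have d0 k : 0 < d k by apply: divr_gt0 => //; apply: divr_gt0 => //; rewrite ltr0n expn_gt0.
have /choice[U hU] k := lebesgue_regularity_outer (mE k) (muE k) (d0 k).
have oU k : open (U k) by have [] := hU k.
have mU k : measurable (U k) by exact: open_measurable.
have EU k : E k `<=` U k by have [] := hU k.
have UEd k : (mu (U k `\` E k) < (d k)%:E)%E by have [] := hU k.
pose w x := (\sum_(k <oo) (c k)%:E * (\1_(U k) x)%:E)%E.
have w0 k x : (0 <= (c k)%:E * (\1_(U k) x)%:E)%E.
  by rewrite mule_ge0 ?lee_fin// ltW.
have mw1 k A : measurable_fun A (fun x => (c k)%:E * (\1_(U k) x)%:E)%E.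
  apply: measurable_funeM; apply/measurable_EFinP.
  exact: measurable_indic.
have mw A : measurable_fun A w.
  rewrite (_ : w = fun x => \sum_(k <oo | k \in xpredT) (c k)%:E * (\1_(U k) x)%:E)%E //.
  exact: ge0_emeasurable_sum.
have w0' x : (0 <= w x)%E by apply: nneseries_ge0.
have wD : (\int[mu]_(x in D) w x <= \int[mu]_(x in D) `|dh x|%:E + eps%:E)%E.
  pose f x := (`|dh x|%:E + e%:E)%E.
  have mf A : measurable_fun A f.
    apply: emeasurable_funD => //; apply/measurable_EFinP.
    apply: (measurableT_comp (f := @Num.norm R R)) => //.
    exact: (measurable_funS _ _ mdh).
  have f0 x : (0 <= f x)%E by rewrite adde_ge0// lee_fin// ltW.
  have -> : (\int[mu]_(x in D) w x = \sum_(k <oo) (c k)%:E * mu (U k `&` D))%E.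
    by apply: integral_series_indic => // k; exact: ltW.
  apply: (@le_trans _ _ (\sum_(k <oo) ((c k)%:E * mu (E k) + (e / (2 ^ k.+1)%:R)%:E))%E).
    apply: lee_nneseries => k *; first by rewrite mule_ge0// lee_fin ltW.
    have -> : (e / (2 ^ k.+1)%:R)%:E = ((c k)%:E * (d k)%:E)%E.
      by rewrite -EFinM /d [c k * _]mulrC divfK// gt_eqF.
    rewrite -ge0_muleDr//; last by rewrite lee_fin ltW.
    rewrite lee_pmul2l//; last by rewrite lte_fin.
    apply: (@le_trans _ _ (mu (U k))).
      by apply: le_measure; rewrite ?inE; [exact: (measurableI _ _ (mU k) mD)|exact: mU|exact: subIsetl].
    have -> : mu (U k) = (mu (E k) + mu (U k `\` E k))%E.
      rewrite -[in LHS](setDUK (EU k)); apply: measureU; first exact: mE.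
        exact: (measurableD (mU k) (mE k)).
      by rewrite setDIK.
    by rewrite leeD// ltW.
  apply: le_trans; first apply: epsilon_trick; [|exact: ltW|].
    by move=> k; rewrite mule_ge0// lee_fin ltW.
  apply: (@le_trans _ _ (\int[mu]_(x in D) f x + e%:E)%E).
    rewrite leeD2r// UE ge0_integral_bigcup//; last exact: mf.
    apply: lee_nneseries => k *; first by rewrite mule_ge0// lee_fin ltW.
    apply: cst_le_integral; [exact: mE|exact: mf|exact/ltW/c0|].
    move=> x [_ /= /andP[kx _]]; rewrite /f -EFinD lee_fin /c -natr1 mulrDl mul1r.
    by rewrite lerD2r.
  rewrite /f ge0_integralD//; last 2 first.
    apply/measurable_EFinP; apply: (measurableT_comp (f := @Num.norm R R)) => //.
    exact: (measurable_funS _ _ mdh).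
    by move=> *; rewrite lee_fin ltW.
  rewrite -addeA leeD2l// integral_cst//= -/mu muD -EFinM -EFinD lee_fin.
  by rewrite /e -{2}[eps / _]mulr1 -mulrDr divfK// gt_eqF//; lra.
(* It remains to bound the increments of [h] by the integral of [w], which is additive over adjacent
   intervals. Around a point of [E k], the increments of [h] from that point have slope at most
   [c k], while [w] is at least [c k] on the open set [U k]. *)
apply: le_trans wD; apply: (local_to_global
  (Q := fun x y => `|h y - h x|%:E <= \int[mu]_(t in `[x, y]) w t)%E) => //.
- move=> x y z ax xy yz zb Qxy Qyz.
  have xyz : [set` `[x, z]] = [set` `[x, y]] `|` [set` `]y, z]].
    by rewrite (@itv_bndbnd_setU _ _ _ (BRight y)) ?bnd_simp.
  have -> : (\int[mu]_(t in `[x, z]) w t =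
      \int[mu]_(t in `[x, y]) w t + \int[mu]_(t in `[y, z]) w t)%E.
    rewrite xyz; etransitivity; first apply: ge0_integral_setU.
    - exact: measurable_itv.
    - exact: measurable_itv.
    - exact: mw.
    - by [].
    - apply/disj_setPS => t [/=]; rewrite !in_itv/= => /andP[_ ty] /andP[yt _].
      by move: (lt_le_trans yt ty); rewrite ltxx.
    congr (_ + _)%E; apply: integral_itv_obnd_cbnd; exact: mw.
  apply: le_trans (leeD Qxy Qyz); rewrite -EFinD lee_fin.
  by rewrite -(subrKA (h y)) addrC ler_normD.
- move=> x /andP[ax xb].
  have : D x by rewrite /D/= in_itv/= ax.
  rewrite UE => -[k _ Ekx].
  have [_ /= /andP[_ xc]] := Ekx.
  have [e1 e10 he1] := is_derive_local_bound (hdh x) xc.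
  have /nbhs_ballP[e2 /= e20 he2] : nbhs x (U k).
    by apply: open_nbhs_nbhs; split; [exact: oU|exact: EU].
  have H y z : y <= z -> `[y, z]%classic `<=` U k ->
      ((c k * (z - y))%:E <= \int[mu]_(t in `[y, z]) w t)%E.
    move=> yz yzU.
    have muyz : mu `[y, z]%classic = (z - y)%:E.
      rewrite /mu lebesgue_measure_itv/= lte_fin lt_neqAle yz andbT; case: eqVneq => [->|//].
      by rewrite subrr.
    rewrite EFinM -muyz; apply: cst_le_integral; [exact: measurable_itv|exact: mw|exact/ltW/c0|].
    move=> t /yzU Ukt; apply: le_trans (nneseries_lim_ge k.+1 _) => //.
    rewrite big_mkord big_ord_recr/= indicE mem_set// mule1 leeDr//.
    by apply: sume_ge0.
  exists (Num.min e1 e2); first by rewrite lt_min e10.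
  split => y yl yx yx'.
    have yxn : `|y - x| < Num.min e1 e2 by rewrite ler0_norm; lra.
    move: yxn; rewrite lt_min => /andP[yx1 yx2].
    apply: le_trans (H y x yx' _).
      rewrite lee_fin distrC; apply: (le_trans (he1 y yx1)).
      by rewrite ler0_norm ?opprB//; lra.
    move=> t /=; rewrite in_itv/= => /andP[yt tx]; apply: he2.
    rewrite /ball/= ger0_norm; last lra.
    by move: yx2; rewrite ler0_norm; lra.
  have yxn : `|y - x| < Num.min e1 e2 by rewrite ger0_norm; lra.
  move: yxn; rewrite lt_min => /andP[yx1 yx2].
  apply: le_trans (H x y yx' _).
    rewrite lee_fin; apply: (le_trans (he1 y yx1)).
    by rewrite ger0_norm//; lra.
  move=> t /=; rewrite in_itv/= => /andP[yt tx]; apply: he2.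
  rewrite /ball/= ler0_norm; last lra.
  by move: yx2; rewrite ger0_norm; lra.
Qed.

(** * Measurability of functions of Caratheodory type *)

Section Caratheodory.
Context (R : realType) (n : nat) (dS dT : measure_display)
  (S : measurableType dS) (T : measurableType dT).
Implicit Types (F : 'rV[R]_n -> T -> R) (X : S -> 'rV[R]_n).

(** Measurability of random vectors is expressed coordinate by coordinate, so that no sigma-algebra
    on ['rV[R]_n] intervenes. *)
Definition measurable_coord X :=
  forall i, measurable_fun setT (fun s => X s 0 i).

Lemma measurable_coordD X Y : measurable_coord X -> measurable_coord Y ->
  measurable_coord (fun s => X s + Y s).
Proof.
move=> mX mY i; under eq_fun do rewrite mxE.
exact: measurable_funD.
Qed.

Lemma measurable_coord_cst v : measurable_coord (fun=> v).
Proof. by move=> i; exact: measurable_cst. Qed.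

Lemma measurable_coordZ (a : S -> R) X : measurable_fun setT a ->
  measurable_coord X -> measurable_coord (fun s => a s *: X s).
Proof.
move=> ma mX i; under eq_fun do rewrite mxE.
exact: measurable_funM.
Qed.

(** Rounding down to the lattice of mesh [1 / m.+1]: the rounded vector takes countably many values
    and tends to [v]. *)
Let grid (m : nat) (v : 'rV[R]_n) : {ffun 'I_n -> int} :=
  [ffun i => Num.floor (m.+1%:R * v 0 i)].
Let node (m : nat) (z : {ffun 'I_n -> int}) : 'rV[R]_n :=
  \row_i ((z i)%:~R / m.+1%:R).

Let node_cvg (v : 'rV[R]_n) : node m (grid m v) @[m --> \oo] --> v.
Proof.
apply/cvg_ballP => e e0.
near=> m; split => // i j.
rewrite /ball/= !mxE ord1 ffunE.
have m0 : 0 < m.+1%:R :> R by [].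
have := Num.Theory.floor_itv (m.+1%:R * v 0 j).
move: (Num.floor _) => z; rewrite intrD => /andP[h1 h2].
have -> : v 0 j - z%:~R / m.+1%:R = (m.+1%:R * v 0 j - z%:~R) / m.+1%:R.
  by rewrite mulrBl mulrAC divff ?mul1r// lt0r_neq0.
rewrite ger0_norm ?divr_ge0 ?subr_ge0// ltr_pdivrMr//.
apply: (@lt_trans _ _ 1); first lra.
rewrite mulrC -ltr_pdivrMr// div1r.
near: m; exists (Num.truncn e^-1) => // m /= em.
by rewrite (lt_le_trans (Num.Theory.truncnS_gt _))// ler_nat.
Unshelve. all: by end_near. Qed.

(** With [X] rounded to the lattice, a preimage is a countable union of measurable rectangles;
    continuity of [F] in its vector argument lets the mesh tend to 0. *)
Lemma measurable_caratheodory F X :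
  (forall x, measurable_fun setT (F x)) -> (forall w, continuous (F ^~ w)) ->
  measurable_coord X -> measurable_fun setT (fun p : S * T => F (X p.1) p.2).
Proof.
move=> mF cF mX.
apply: (measurable_fun_cvg (h := fun m p => F (node m (grid m (X p.1))) p.2)).
- move=> m _ B mB; rewrite setTI.
  rewrite (_ : _ @^-1` B = \bigcup_z
    ([set s | grid m (X s) = z] `*` (F (node m z) @^-1` B))); last first.
    apply/seteqP; split => [[s w] /= Bsw|[s w] [z _ /= [-> ]]]//.
    by exists (grid m (X s)).
  apply: countable_bigcupT_measurable; first exact: countableP.
  move=> z; apply: measurableX; last first.
    by rewrite -[X in measurable X]setTI; exact: mF.
  rewrite (_ : [set s | _] = \bigcap_i
     [set s | (z i)%:~R <= m.+1%:R * X s 0 i < (z i + 1)%:~R]).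
    apply: fin_bigcap_measurable; first exact: finite_finset.
    move=> i _; rewrite (_ : [set s | _] =
        (fun s => m.+1%:R * X s 0 i) @^-1` `[(z i)%:~R, (z i + 1)%:~R[).
      rewrite -[X in measurable X]setTI.
      by apply: measurable_funM => //; exact: mX.
    by apply/seteqP; split => s /=; rewrite in_itv.
  apply/seteqP; split => [s /= <- i _|s /= H].
    by rewrite /= ffunE; exact: Num.Theory.floor_itv.
  by apply/ffunP => i; rewrite ffunE; apply/Num.Theory.floor_def; exact: H.
- move=> [s w] _ /=; have := cF w (X s).
  by move/(cvg_comp _ _ (@node_cvg (X s))).
Qed.

Lemma invS_dnbhs : ((k.+1%:R^-1 : R) @[k --> \oo]) --> (0 : R)^'.
Proof.
move=> A [e /= e0 eA].
have [N _ hN] := @near_infty_natSinv_lt R (PosNum e0).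
exists N => // k /hN /= ke; apply: eA => /=.
  by rewrite /ball/= sub0r normrN ger0_norm ?invr_ge0.
by rewrite gt_eqF// invr_gt0.
Qed.

Lemma measurable_deriv F X (v : 'rV[R]_n) :
  (forall x, measurable_fun setT (F x)) ->
  (forall w (x : 'rV[R]_n), differentiable (F ^~ w) x) ->
  measurable_coord X ->
  measurable_fun setT (fun p : S * T => 'D_v (F ^~ p.2) (X p.1)).
Proof.
move=> mF dF mX.
have cF w : continuous (F ^~ w).
  by move=> x; exact: differentiable_continuous.
apply: (measurable_fun_cvg (h := fun k p => (k.+1%:R^-1 : R)^-1 *
  (F (k.+1%:R^-1 *: v + X p.1) p.2 - F (X p.1) p.2))).
- move=> k; apply: measurable_funM => //; apply: measurable_funB.
    apply: (measurable_caratheodory (X := fun s => _ *: v + X s)) => //.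
    by apply: measurable_coordD => //; exact: measurable_coord_cst.
  exact: (measurable_caratheodory mF cF mX).
- move=> [s w] _ /=.
  have := @diff_derivable _ _ _ _ _ v (dF w (X s)).
  by move/(cvg_comp _ _ invS_dnbhs).
Qed.

End Caratheodory.

Lemma measurable_continuous_coord (R : realType) (n : nat) (dS : measure_display)
  (S : measurableType dS) (g : 'rV[R]_n -> R) (X : S -> 'rV[R]_n) :
  continuous g -> measurable_coord X -> measurable_fun setT (fun s => g (X s)).
Proof.
move=> cg mX.
have := @measurable_caratheodory R n _ _ S S (fun x _ => g x) X
  (fun x => measurable_cst _) (fun=> cg) mX.
move=> /measurableT_comp/(_ (measurable_fun_pair (@measurable_id _ S setT) (@measurable_id _ S setT))).
exact.
Qed.

(** * Euclidean norm and second moments *)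

Section EuclideanNorm.
Context (R : realType) (n : nat).
Implicit Types u v : 'rV[R]_n.

Definition dotv u v : R := \sum_(i < n) u 0 i * v 0 i.

Lemma norm2_ge0 v : 0 <= norm2 v.
Proof. exact: sqrtr_ge0. Qed.

Lemma norm2_sqr v : norm2 v ^+ 2 = \sum_(i < n) v 0 i ^+ 2.
Proof. by rewrite sqr_sqrtr// sumr_ge0// => i _; rewrite sqr_ge0. Qed.

Lemma norm20 : norm2 (0 : 'rV[R]_n) = 0.
Proof.
by apply/eqP; rewrite -sqrf_eq0 norm2_sqr big1// => i _; rewrite mxE expr0n.
Qed.

Lemma norm2Z c v : norm2 (c *: v) = `|c| * norm2 v.
Proof.
apply/eqP; rewrite -(@eqrXn2 _ 2)// ?mulr_ge0 ?norm2_ge0//.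
rewrite exprMn !norm2_sqr mulr_sumr real_normK ?num_real//.
by apply/eqP; apply: eq_bigr => i _; rewrite mxE exprMn.
Qed.

Lemma norm2N v : norm2 (- v) = norm2 v.
Proof. by rewrite -scaleN1r norm2Z normrN1 mul1r. Qed.

Lemma dotvDl u u' v : dotv (u + u') v = dotv u v + dotv u' v.
Proof. by rewrite -big_split; apply: eq_bigr => i _; rewrite mxE mulrDl. Qed.

Lemma dotvNl u v : dotv (- u) v = - dotv u v.
Proof. by rewrite -sumrN; apply: eq_bigr => i _; rewrite mxE mulNr. Qed.

Lemma dotvC u v : dotv u v = dotv v u.
Proof. by apply: eq_bigr => i _; rewrite mulrC. Qed.

Lemma dotvZl c u v : dotv (c *: u) v = c * dotv u v.
Proof. by rewrite mulr_sumr; apply: eq_bigr => i _; rewrite mxE mulrA. Qed.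

Lemma dotvv v : dotv v v = norm2 v ^+ 2.
Proof. by rewrite norm2_sqr; apply: eq_bigr => i _; rewrite expr2. Qed.

Lemma norm2B_sqr u v :
  norm2 (u - v) ^+ 2 = norm2 u ^+ 2 - 2 * dotv u v + norm2 v ^+ 2.
Proof.
rewrite -!dotvv dotvDl dotvNl 2!(dotvC _ (u - v)) !dotvDl !dotvNl (dotvC v u).
by ring.
Qed.

(** Cauchy-Schwarz, from [0 <= norm2 (norm2 y *: x - norm2 x *: y) ^+ 2] divided by the product of
    the norms; hence the separate treatment of a zero norm. *)
Lemma norm_dotv u v : `|dotv u v| <= norm2 u * norm2 v.
Proof.
have H (x y : 'rV[R]_n) : dotv x y <= norm2 x * norm2 y.
  have [x0|] := eqVneq (norm2 x) 0.
    rewrite x0 mul0r /dotv big1// => i _.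
    have : \sum_(j < n) x 0 j ^+ 2 == 0 by rewrite -norm2_sqr x0 expr0n.
    rewrite psumr_eq0; last by move=> j _; rewrite sqr_ge0.
    by move/allP/(_ i); rewrite mem_index_enum sqrf_eq0 => /(_ isT)/eqP ->; rewrite mul0r.
  have [y0|y0 x0] := eqVneq (norm2 y) 0.
    rewrite y0 mulr0 /dotv big1// => i _.
    have : \sum_(j < n) y 0 j ^+ 2 == 0 by rewrite -norm2_sqr y0 expr0n.
    rewrite psumr_eq0; last by move=> j _; rewrite sqr_ge0.
    by move/allP/(_ i); rewrite mem_index_enum sqrf_eq0 => /(_ isT)/eqP ->; rewrite mulr0.
  have p : 0 < norm2 x * norm2 y.
    by rewrite mulr_gt0// lt_neqAle eq_sym ?x0 ?y0 norm2_ge0.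
  have := sqr_ge0 (norm2 (norm2 y *: x - norm2 x *: y)).
  rewrite norm2B_sqr !norm2Z !ger0_norm ?norm2_ge0// dotvZl dotvC dotvZl dotvC.
  move=> h; have {h} : 0 <= (norm2 x * norm2 y) * (norm2 x * norm2 y - dotv x y).
    by move: h; move: (dotv x y) (norm2 x) (norm2 y) => a b c; lra.
  by rewrite pmulr_rge0// subr_ge0.
by rewrite ler_norml H andbT lerNl -dotvNl (le_trans (H _ _))// norm2N.
Qed.

Lemma ler_norm2D u v : norm2 (u + v) <= norm2 u + norm2 v.
Proof.
rewrite -ler_sqr ?nnegrE ?addr_ge0 ?norm2_ge0//.
rewrite -[v in u + v]opprK norm2B_sqr norm2N dotvC dotvNl dotvC.
by have := ler_norm (dotv u v); have := norm_dotv u v; lra.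
Qed.

Lemma norm2_le_sqrt v : norm2 v <= n%:R * `|v|.
Proof.
have h i : `|v 0 i| <= `|v|.
  by rewrite [leRHS]/Num.norm/= mx_normE; apply: (le_bigmax _ (fun i => `|v i.1 i.2|%:nng) (0, i)).
apply: (@le_trans _ _ (\sum_(i < n) `|v 0 i|)).
  rewrite -ler_sqr ?nnegrE ?sumr_ge0 ?norm2_ge0// norm2_sqr.
  rewrite expr2 mulr_sumr; apply: ler_sum => i _.
  rewrite -real_normK ?num_real// expr2 ler_wpM2r//.
  by rewrite (bigD1 i)//= lerDl sumr_ge0.
rewrite mulr_natl -[X in _ *+ X]card_ord -sumr_const.
by apply: ler_sum => i _.
Qed.

Lemma norm2_lipschitz_continuous (g : 'rV[R]_n -> R) (L : R) :
  (forall x y, `|g x - g y| <= L * norm2 (x - y)) -> continuous g.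
Proof.
move=> hg x; apply/(@cvgrPdist_le _ _ _ (nbhs x) (nbhs_filter x)) => e e0.
have K0 : 0 < `|L| * n%:R + 1 by rewrite ltr_wpDl// mulr_ge0.
near=> y; apply: le_trans (hg x y) _.
apply: (@le_trans _ _ ((`|L| * n%:R + 1) * `|x - y|)).
  have h1 : L * norm2 (x - y) <= `|L| * norm2 (x - y).
    by rewrite ler_wpM2r ?norm2_ge0// ler_norm.
  have h2 : `|L| * norm2 (x - y) <= `|L| * (n%:R * `|x - y|).
    by rewrite ler_wpM2l// norm2_le_sqrt.
  by have := normr_ge0 (x - y); lra.
rewrite -ler_pdivlMl// mulrC; near: y.
by apply: cvgr_dist_le => //; rewrite divr_gt0.
Unshelve. all: by end_near. Qed.

End EuclideanNorm.

Section SecondMoments.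
Context (R : realType) (d : measure_display) (T : measurableType d)
  (P : probability T R).
Implicit Types f g : T -> R.

Lemma integrable_cstR (c : R) : P.-integrable setT (EFin \o (fun=> c)).
Proof. exact: (finite_measure_integrable_cst P c measurableT). Qed.

Lemma integrableDR f g : P.-integrable setT (EFin \o f) ->
  P.-integrable setT (EFin \o g) -> P.-integrable setT (EFin \o (fun w => f w + g w)).
Proof. by move=> fi gi; exact: (integrableD measurableT fi gi). Qed.

Lemma integrableZR (c : R) f : P.-integrable setT (EFin \o f) ->
  P.-integrable setT (EFin \o (fun w => c * f w)).
Proof. by move=> fi; exact: (integrableZl measurableT c fi). Qed.

Lemma integrable_le f g : measurable_fun setT f ->
  (forall w, `|f w| <= g w) -> P.-integrable setT (EFin \o g) ->
  P.-integrable setT (EFin \o f).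
Proof.
move=> mf fg; apply: le_integrable => //; first exact/measurable_EFinP.
by move=> w _; rewrite /= lee_fin (le_trans (fg w))// ler_norm.
Qed.

Lemma ge0_integrableP f (K : R) : measurable_fun setT f -> (forall w, 0 <= f w) ->
  (\int[P]_w (f w)%:E <= K%:E)%E ->
  P.-integrable setT (EFin \o f) /\ \int[P]_w f w <= K.
Proof.
move=> mf f0 fK.
have fi : P.-integrable setT (EFin \o f).
  apply/integrableP; split; first exact/measurable_EFinP.
  under eq_integral => w _ do rewrite /= ger0_norm//.
  by rewrite (le_lt_trans fK)// ltry.
split=> //; rewrite -lee_fin /Rintegral fineK//.
exact: integrable_fin_num.
Qed.

Lemma EFin_Rintegral f : P.-integrable setT (EFin \o f) ->
  (\int[P]_w f w)%:E = (\int[P]_w (f w)%:E)%E.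
Proof. by move=> fi; rewrite /Rintegral fineK//; exact: integrable_fin_num. Qed.

Lemma square_integrable f (K : R) : measurable_fun setT f ->
  (\int[P]_w (f w ^+ 2)%:E <= K%:E)%E -> P.-integrable setT (EFin \o f).
Proof.
move=> mf fK.
have [i2 _] : P.-integrable setT (EFin \o (fun w => f w ^+ 2)) /\ _ :=
  ge0_integrableP (measurable_funX 2 mf) (fun w => sqr_ge0 (f w)) fK.
apply: (integrable_le mf _ (integrableDR (integrable_cstR 1) i2)) => w.
have := sqr_ge0 (`|f w| - 1); rewrite sqrrB1 real_normK ?num_real//.
by have := normr_ge0 (f w); lra.
Qed.

Lemma Rintegral_cstP (c : R) : \int[P]_w c = c.
Proof. by rewrite Rintegral_cst//= probability_setT mulr1. Qed.

(** Jensen for the square: integrate [2 * c * f <= f ^+ 2 + c ^+ 2] with [c] the mean of [f]. *)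
Lemma Rintegral_sqr_le f (K : R) : measurable_fun setT f ->
  (\int[P]_w (f w ^+ 2)%:E <= K%:E)%E -> (\int[P]_w f w) ^+ 2 <= K.
Proof.
move=> mf fK; have fi := square_integrable mf fK.
have [i2 e2] := ge0_integrableP (measurable_funX 2 mf) (fun w => sqr_ge0 (f w)) fK.
set c := \int[P]_w f w.
have : \int[P]_w (2 * c * f w) <= \int[P]_w (f w ^+ 2 + c ^+ 2).
  apply: le_Rintegral => //.
  - exact: integrableZR.
  - by apply: integrableDR => //; exact: integrable_cstR.
  - by move=> w _; have := sqr_ge0 (f w - c); rewrite sqrrB; lra.
rewrite RintegralZl// RintegralD//; last exact: integrable_cstR.
rewrite Rintegral_cstP -/c => h; apply: le_trans e2.
by move: h; lra.
Qed.

(** Bounded second moments make the differences [Z - Y k] uniformly integrable. Cut at height [N],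
    [|Z - Y k|] has vanishing mean by dominated convergence; what exceeds [N] has mean at most
    [e / 2], uniformly in [k]. *)
Lemma cvg_mean_of_second_moment (Y : nat -> T -> R) (Z : T -> R) (K : R) :
  (forall k, measurable_fun setT (Y k)) -> measurable_fun setT Z ->
  (forall w, Y ^~ w @ \oo --> Z w) ->
  (forall k, \int[P]_w (Y k w ^+ 2)%:E <= K%:E)%E ->
  (\int[P]_w (Z w ^+ 2)%:E <= K%:E)%E ->
  (\int[P]_w Y k w) @[k --> \oo] --> \int[P]_w Z w.
Proof.
move=> mY mZ YZ YK ZK.
have Yi k := square_integrable (mY k) (YK k).
have Zi := square_integrable mZ ZK.
have [Z2i Z2] := ge0_integrableP (measurable_funX 2 mZ) (fun w => sqr_ge0 (Z w)) ZK.
have K0 : 0 <= K.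
  by rewrite -lee_fin; apply: le_trans ZK; apply: integral_ge0 => w _; rewrite lee_fin sqr_ge0.
apply/cvgrPdist_lt => e e0.
(* Makes the tail [2 / N * (2 * K)] equal to [e / 2 * (K / (K + 1))]; the [+ 1] covers [K = 0]. *)
pose N := 8 * (K + 1) / e.
have N0 : 0 < N by rewrite divr_gt0// mulr_gt0//; lra.
pose U k w := Num.min `|Z w - Y k w| N.
have mU k : measurable_fun setT (U k).
  apply: measurable_minr; last exact: measurable_cst.
  by apply: (measurableT_comp (f := @Num.norm R R)) => //; exact: measurable_funB.
have U0 k w : 0 <= U k w by rewrite /U le_min normr_ge0 ltW.
have Ui k : P.-integrable setT (EFin \o U k).
  apply: (integrable_le (mU k) _ (integrable_cstR N)) => w.
  by rewrite ger0_norm// /U ge_min lexx orbT.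
have Ucvg : (\int[P]_w (U k w)%:E)%E @[k --> \oo] --> 0%E.
  have [] := @dominated_convergence _ _ _ P setT measurableT
    (fun k w => (U k w)%:E) (cst 0%E) (cst N%:E).
  - by move=> k; exact/measurable_EFinP.
  - exact: measurable_cst.
  - apply: aeW => w _; apply: cvg_EFin.
      by apply: nearW => k.
    apply: (@squeeze_cvgr _ _ _ _ (fun=> 0) (fun k => `|Z w - Y k w|)).
    - by apply: nearW => k; rewrite U0 /U ge_min lexx.
    - exact: cvg_cst.
    - rewrite -(normr0 R); apply: cvg_norm; rewrite -(subrr (Z w)).
      by apply: cvgB; [exact: cvg_cst|exact: YZ].
  - exact: (integrable_cstR N).
  - apply: aeW => w k _; rewrite /= lee_fin ger0_norm// /U ge_min lexx orbT//.
  by rewrite integral0.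
have {}Ucvg : (\int[P]_w U k w) @[k --> \oo] --> 0.
  exact: (fine_cvg (a := 0) Ucvg).
have main k : `|\int[P]_w Z w - \int[P]_w Y k w| <= \int[P]_w U k w + e / 2.
  have [Y2i Y2] := ge0_integrableP (measurable_funX 2 (mY k)) (fun w => sqr_ge0 (Y k w)) (YK k).
  rewrite -RintegralB//; apply: (le_trans (le_normr_Rintegral _ _)) => //.
    exact: (integrableB measurableT Zi (Yi k)).
  have hi : P.-integrable setT (EFin \o (fun w => U k w + 2 / N * (Z w ^+ 2 + Y k w ^+ 2))).
    by apply: integrableDR => //; apply: integrableZR; exact: integrableDR.
  (* Chebyshev: [|z| <= z ^ 2 / N] where [|z| > N]. *)
  have hU w : `|Z w - Y k w| <= U k w + 2 / N * (Z w ^+ 2 + Y k w ^+ 2).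
    have q0 : 0 <= 2 / N * (Z w ^+ 2 + Y k w ^+ 2).
      by rewrite mulr_ge0 ?addr_ge0 ?sqr_ge0// divr_ge0// ltW.
    rewrite /U; case: (leP `|Z w - Y k w| N) => [_|h]; first by rewrite lerDl.
    apply: (@le_trans _ _ (2 / N * (Z w ^+ 2 + Y k w ^+ 2))); last by rewrite lerDr ltW.
    have -> : 2 / N * (Z w ^+ 2 + Y k w ^+ 2) = (2 * (Z w ^+ 2 + Y k w ^+ 2)) / N.
      by rewrite mulrAC.
    rewrite ler_pdivlMr//.
    apply: (@le_trans _ _ (`|Z w - Y k w| ^+ 2)); first by rewrite expr2 ler_wpM2l// ltW.
    rewrite real_normK ?num_real//.
    by have := sqr_ge0 (Z w + Y k w); rewrite sqrrD sqrrB; lra.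
  apply: (@le_trans _ _ (\int[P]_w (U k w + 2 / N * (Z w ^+ 2 + Y k w ^+ 2)))).
    apply: le_Rintegral => //.
    apply: (integrable_le _ _ hi) => [|w]; last by rewrite normr_id.
    by apply: (measurableT_comp (f := @Num.norm R R)) => //; exact: measurable_funB.
  rewrite RintegralD//; last by apply: integrableZR; exact: integrableDR.
  rewrite lerD2l RintegralZl//; last exact: integrableDR.
  rewrite RintegralD//.
  apply: (@le_trans _ _ (2 / N * (2 * K))).
    by rewrite ler_wpM2l ?divr_ge0 ?(ltW N0)//; lra.
  have -> : 2 / N * (2 * K) = e / 2 * (K / (K + 1)).
    rewrite /N; field; rewrite !gt_eqF//; lra.
  by rewrite ler_piMr ?divr_ge0 ?(ltW e0)// ler_pdivrMr; lra.
near=> k; apply: le_lt_trans (main k) _.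
suff : \int[P]_w U k w < e / 2 by lra.
have : `|0 - \int[P]_w U k w| < e / 2.
  by near: k; move/cvgrPdist_lt: Ucvg; apply; rewrite divr_gt0.
by rewrite sub0r normrN; apply: le_lt_trans; exact: ler_norm.
Unshelve. all: by end_near. Qed.

End SecondMoments.

(** * Differentiability of the objective *)

Lemma is_derive_cvg (R : realType) (V : normedModType R) (g : V -> R) (x v : V) (l : R) :
  h^-1 *: ((g \o shift x) (h *: v) - g x) @[h --> 0^'] --> l ->
  is_derive x v g l.
Proof. by move=> gl; apply: DeriveDef; [exact: (cvgP l) | exact: cvg_lim]. Qed.

Lemma is_derive_line (R : realType) (V : normedModType R) (g : V -> R) (x v : V) (t l : R) :
  is_derive (x + t *: v) v g l -> is_derive t (1 : R) (fun s : R => g (x + s *: v)) l.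
Proof.
move=> [dg <-]; apply: is_derive_cvg.
rewrite [X in X @ _](_ : _ =
  fun h => h^-1 *: ((g \o shift (x + t *: v)) (h *: v) - g (x + t *: v))).
  exact: dg.
by apply/funext => h /=; rewrite [_%:A]mulr1 scalerDl addrCA.
Qed.

Lemma measurable_gradF (R : realType) (n : nat) (dS dT : measure_display)
  (S : measurableType dS) (T : measurableType dT) (F : 'rV[R]_n -> T -> R)
  (X : S -> 'rV[R]_n) (W : S -> T) :
  (forall x, measurable_fun setT (F x)) ->
  (forall w (x : 'rV[R]_n), differentiable (F ^~ w) x) ->
  measurable_coord X -> measurable_fun setT W ->
  measurable_coord (fun s => gradF F (X s) (W s)).
Proof.
move=> mF dF mX mW i.
have := measurable_deriv (delta_mx 0 i) mF dF mX.
move=> /measurableT_comp/(_ (measurable_fun_pair (@measurable_id _ S setT) mW)).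
by apply: eq_measurable_fun => s _ /=; rewrite mxE.
Qed.

Lemma measurable_dotv (R : realType) (n : nat) (dS : measure_display)
  (S : measurableType dS) (X Y : S -> 'rV[R]_n) :
  measurable_coord X -> measurable_coord Y ->
  measurable_fun setT (fun s => dotv (X s) (Y s)).
Proof. by move=> mX mY; apply: measurable_sum => i; exact: measurable_funM. Qed.

Lemma measurable_norm2 (R : realType) (n : nat) (dS : measure_display)
  (S : measurableType dS) (X : S -> 'rV[R]_n) :
  measurable_coord X -> measurable_fun setT (fun s => norm2 (X s)).
Proof.
move=> mX; apply: (measurable_continuous_coord (g := @norm2 R n)) => //.
apply: (norm2_lipschitz_continuous (L := 1)) => x y.
rewrite mul1r ler_norml; have := ler_norm2D (x - y) y; rewrite subrK.
have := ler_norm2D (y - x) x; rewrite subrK -opprB norm2N.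
by move=> *; apply/andP; split; lra.
Qed.

Lemma Rintegral_sum (d : measure_display) (T : measurableType d) (R : realType)
  (P : probability T R) (I : Type) (r : seq I) (f : I -> T -> R) :
  (forall i, P.-integrable setT (EFin \o f i)) ->
  P.-integrable setT (EFin \o (fun w => \sum_(i <- r) f i w)) /\
  \int[P]_w (\sum_(i <- r) f i w) = \sum_(i <- r) \int[P]_w f i w.
Proof.
move=> fi; elim: r => [|i r [IHi IHe]].
  rewrite (_ : (fun w => _) = (fun=> 0)); last by apply/funext => w; rewrite big_nil.
  by rewrite big_nil Rintegral_cstP; split=> //; exact: integrable_cstR.
rewrite (_ : (fun w => _) = (fun w => f i w + \sum_(i <- r) f i w)).
  by rewrite big_cons -IHe -RintegralD//; split=> //; exact: integrableDR.
by apply/funext => w; rewrite big_cons.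
Qed.

(** Integrating [2 * r * |G| <= G ^+ 2 + r ^+ 2] in the extended reals proves this without
    integrability of [G], whose square may have infinite integral. *)
Lemma sqr_le_integral_sqr (d : measure_display) (T : measurableType d)
  (R : realType) (mu : {measure set T -> \bar R}) (I : set T) (G : T -> R) (r : R) :
  measurable I -> mu I = 1%E -> measurable_fun I G -> 0 <= r ->
  (r%:E <= \int[mu]_(t in I) `|G t|%:E)%E ->
  ((r ^+ 2)%:E <= \int[mu]_(t in I) (G t ^+ 2)%:E)%E.
Proof.
move=> mI mu1 mG r0 hr.
have mnG : measurable_fun I (fun t => `|G t|%:E).
  by apply/measurable_EFinP; exact: (measurableT_comp (f := @Num.norm R R)).
have mG2 : measurable_fun I (fun t => (G t ^+ 2)%:E).
  by apply/measurable_EFinP; exact: measurable_funX.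
have h : ((2 * r)%:E * r%:E <=
    \int[mu]_(t in I) ((G t ^+ 2)%:E + (r ^+ 2)%:E))%E.
  apply: (@le_trans _ _ ((2 * r)%:E * \int[mu]_(t in I) `|G t|%:E)%E).
    by apply: lee_wpmul2l => //; rewrite lee_fin mulr_ge0.
  rewrite -ge0_integralZl//; last by rewrite lee_fin mulr_ge0.
  apply: ge0_le_integral => //.
  - by move=> t _; rewrite mule_ge0// lee_fin mulr_ge0.
  - exact: measurable_funeM.
  - exact: emeasurable_funD.
  - move=> t _; rewrite -EFinM -EFinD lee_fin.
    have := sqr_ge0 (r - `|G t|); rewrite sqrrB real_normK ?num_real//; lra.
move: h; rewrite ge0_integralD//; last 2 first.
- by move=> t _; rewrite lee_fin sqr_ge0.
- by move=> t _; rewrite lee_fin sqr_ge0.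
rewrite integral_cst// mu1 mule1 -EFinM -leeBlDr// -EFinB.
by apply: le_trans; rewrite lee_fin; lra.
Qed.

(** Tonelli exchanges the two integrals; the inner one is then at most [K] for every [t], and [I]
    has mass 1. *)
Lemma integral_le_of_sections (d1 d2 : measure_display)
  (S : measurableType d1) (T : measurableType d2) (R : realType)
  (mu : {sigma_finite_measure set S -> \bar R}) (P : probability T R)
  (I : set S) (H : S * T -> \bar R) (g : T -> \bar R) (K : \bar R) :
  measurable I -> mu I = 1%E -> measurable_fun setT H -> (forall p, 0 <= H p)%E ->
  (forall t, \int[P]_w H (t, w) <= K)%E ->
  measurable_fun setT g -> (forall w, 0 <= g w)%E ->
  (forall w, g w <= \int[mu]_(t in I) H (t, w))%E ->
  (\int[P]_w g w <= K)%E.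
Proof.
move=> mI mu1 mH H0 HK mg g0 gH.
pose f (p : S * T) : \bar R := ((\1_I p.1)%:E * H p)%E.
have f0 p : (0 <= f p)%E by rewrite mule_ge0// lee_fin.
have mf : measurable_fun setT f.
  apply: emeasurable_funM => //; apply/measurable_EFinP.
  by apply: measurableT_comp => //; exact: measurable_indic.
have K0 : (0 <= K)%E.
  have [t0 _] : I !=set0.
    apply/set0P/eqP => I0; move: mu1; rewrite I0 measure0 => /esym/eqP.
    by rewrite onee_eq0.
  by apply: le_trans (HK t0); apply: integral_ge0 => w _.
have fE w : (\int[mu]_(t in I) H (t, w) = \int[mu]_t f (t, w))%E.
  rewrite integral_mkcond; apply: eq_integral => t _.
  by rewrite /patch /f/= indicE; case: ifP; rewrite ?mul1e ?mul0e.
apply: (@le_trans _ _ (\int[P]_w \int[mu]_t f (t, w))%E).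
  apply: ge0_le_integral => //.
  - exact: (measurable_fun_fubini_tonelli_G f mf f0).
  - by move=> w _; rewrite -fE gH.
rewrite -(fubini_tonelli f mf f0).
apply: (@le_trans _ _ (\int[mu]_t ((\1_I t)%:E * K))%E).
  apply: ge0_le_integral => //.
  - by move=> t _; apply: integral_ge0 => w _.
  - exact: (measurable_fun_fubini_tonelli_F f mf f0).
  - by apply: emeasurable_funM => //; apply/measurable_EFinP; exact: measurable_indic.
  - move=> t _; rewrite /f/= ge0_integralZl//.
    + by apply: lee_wpmul2l => //; rewrite lee_fin.
    + exact: measurableT_comp mH _.
rewrite ge0_integralZr//; last first.
  by apply/measurable_EFinP; exact: measurable_indic.
rewrite integral_indic// setIT -[leRHS]mul1e le_eqVlt; apply/orP; left.
by apply/eqP; congr (_ * _)%E; exact: mu1.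
Qed.

Section SmoothObjective.
Context (R : realType) (n : nat) (d : measure_display) (T : measurableType d)
  (P : probability T R) (F : 'rV[R]_n -> T -> R) (C : R).
Hypothesis mF : forall x, measurable_fun setT (F x).
Hypothesis iF : forall x, P.-integrable setT (EFin \o F x).
Hypothesis dF : forall w (x : 'rV[R]_n), differentiable (F ^~ w) x.
Hypothesis hC : forall x, (\int[P]_w (norm2 (gradF F x w) ^+ 2)%:E <= C%:E)%E.

Lemma second_moment_ge0 : 0 <= C.
Proof.
rewrite -lee_fin; apply: le_trans (hC 0); apply: integral_ge0 => w _.
by rewrite lee_fin sqr_ge0.
Qed.

Lemma is_derive_gradF w x v : is_derive x v (F ^~ w) (dotv (gradF F x w) v).
Proof.
apply: DeriveDef; first exact: diff_derivable.
rewrite deriveE// [v in LHS]row_sum_delta linear_sum.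
by apply: eq_bigr => i _; rewrite linearZ /= mxE -deriveE// mulrC.
Qed.

Lemma measurable_gradF_cst x : measurable_coord (fun w => gradF F x w).
Proof.
exact: (measurable_gradF mF dF (measurable_coord_cst x) (@measurable_id _ T setT)).
Qed.

Lemma measurable_dotv_gradF x v : measurable_fun setT (fun w => dotv (gradF F x w) v).
Proof.
exact: (measurable_dotv (@measurable_gradF_cst x) (measurable_coord_cst v)).
Qed.

Lemma second_moment_dotv x v :
  (\int[P]_w (dotv (gradF F x w) v ^+ 2)%:E <= (C * norm2 v ^+ 2)%:E)%E.
Proof.
have mg := @measurable_gradF_cst x.
apply: (@le_trans _ _ (\int[P]_w ((norm2 v ^+ 2)%:E * (norm2 (gradF F x w) ^+ 2)%:E))%E).
  apply: ge0_le_integral => //.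
  - by move=> w _; rewrite lee_fin sqr_ge0.
  - by apply/measurable_EFinP/measurable_funX; exact: measurable_dotv_gradF.
  - by apply: measurable_funeM; apply/measurable_EFinP/measurable_funX/measurable_norm2.
  - move=> w _; rewrite -EFinM lee_fin -exprMn mulrC -real_normK ?num_real//.
    by rewrite lerXn2r ?nnegrE ?mulr_ge0 ?norm2_ge0// norm_dotv.
rewrite ge0_integralZl//; last 3 first.
- by apply/measurable_EFinP/measurable_funX/measurable_norm2.
- by move=> w _; rewrite lee_fin sqr_ge0.
- by rewrite lee_fin sqr_ge0.
rewrite mulrC [leRHS](EFinM (norm2 v ^+ 2) C).
by apply: lee_wpmul2l; rewrite ?lee_fin ?sqr_ge0.
Qed.

Lemma integrable_dotv x v : P.-integrable setT (EFin \o (fun w => dotv (gradF F x w) v)).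
Proof.
apply: square_integrable (second_moment_dotv x v).
exact: measurable_dotv_gradF.
Qed.

Lemma integrable_gradF x i : P.-integrable setT (EFin \o (fun w => gradF F x w 0 i)).
Proof.
have := integrable_dotv x (delta_mx 0 i); congr (_.-integrable _ _).
apply/funext => w /=; congr EFin; rewrite /dotv (bigD1 i)//= big1 ?addr0.
  by rewrite [delta_mx _ _ _ _]mxE !eqxx mulr1.
by move=> j ji; rewrite [delta_mx _ _ _ _]mxE (negPf ji) andbF mulr0.
Qed.

Lemma mean_gradFE x i : mean_gradF P F x 0 i = \int[P]_w gradF F x w 0 i.
Proof. by rewrite mxE unlock. Qed.

Lemma objectiveE x : objective P F x = \int[P]_w F x w.
Proof. by rewrite /objective unlock. Qed.

Lemma Rintegral_dotv x v :
  \int[P]_w dotv (gradF F x w) v = dotv (mean_gradF P F x) v.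
Proof.
have hi i : P.-integrable setT (EFin \o (fun w => v 0 i * gradF F x w 0 i)).
  exact: (integrableZR _ (integrable_gradF x i)).
have [_ e] := Rintegral_sum (index_enum 'I_n) hi.
transitivity (\int[P]_w \sum_(i < n) (v 0 i * gradF F x w 0 i)).
  by apply: eq_Rintegral => w _; apply: eq_bigr => i _; rewrite mulrC.
rewrite e; apply: eq_bigr => i _.
by rewrite RintegralZl//; [rewrite mean_gradFE mulrC|exact: integrable_gradF].
Qed.

(** The second-moment bound is tested in the direction of the mean gradient [c] itself:
    [|c| ^ 4 <= C * |c| ^ 2]. *)
Lemma norm2_mean_gradF x : norm2 (mean_gradF P F x) ^+ 2 <= C.
Proof.
set c := mean_gradF P F x.
have := Rintegral_sqr_le (@measurable_dotv_gradF x c) (second_moment_dotv x c).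
rewrite Rintegral_dotv -/c dotvv.
rewrite expr2; have [->|c0] := eqVneq (norm2 c) 0.
  by rewrite expr0n second_moment_ge0.
by rewrite ler_pM2r// exprn_gt0// lt_neqAle eq_sym c0 norm2_ge0.
Qed.

Let I01 : set R := `[0, 1].

Lemma increment_sqr_le w x v :
  (((F (x + v) w - F x w) ^+ 2)%:E <=
   \int[lebesgue_measure]_(t in I01) (dotv (gradF F (x + t *: v) w) v ^+ 2)%:E)%E.
Proof.
set G := fun t : R => dotv (gradF F (x + t *: v) w) v.
have mG : measurable_fun setT G.
  apply: measurable_dotv; last exact: measurable_coord_cst.
  apply: (measurable_gradF (W := fun=> w)) => //.
  apply: measurable_coordD; first exact: measurable_coord_cst.
  by apply: measurable_coordZ => //; exact: measurable_coord_cst.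
have hG t : is_derive t (1 : R) (fun s : R => F (x + s *: v) w) (G t).
  by apply: (@is_derive_line R _ (F ^~ w)); exact: is_derive_gradF.
have := le_integral_derive (@ler01 R) hG mG.
rewrite scale1r scale0r addr0; set D := F (x + v) w - F x w => hD.
have mu1 : lebesgue_measure I01 = 1%E :> \bar R.
  by rewrite lebesgue_measure_itv/= lte_fin ltr01 sube0.
have mI : measurable I01 by exact: measurable_itv.
rewrite -(real_normK (num_real D)).
by apply: sqr_le_integral_sqr => //; exact: measurable_funS mG.
Qed.

(* No integrability of the derivative along the segment is known beforehand for
   a fixed sample: the bound is infinite where it fails. *)
Lemma increment_second_moment x v :
  (\int[P]_w ((F (x + v) w - F x w) ^+ 2)%:E <= (C * norm2 v ^+ 2)%:E)%E.
Proof.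
have mI : measurable I01 by exact: measurable_itv.
have mu1 : lebesgue_measure I01 = 1%E :> \bar R.
  by rewrite lebesgue_measure_itv/= lte_fin ltr01 sube0.
apply: (@integral_le_of_sections _ _ (measurableTypeR R) T R (@lebesgue_measure R) P
  I01 (fun p => (dotv (gradF F (x + (p.1 : R) *: v) p.2) v ^+ 2)%:E)
  (fun w => ((F (x + v) w - F x w) ^+ 2)%:E) _ mI mu1).
- apply/measurable_EFinP/measurable_funX; apply: measurable_dotv.
    apply: measurable_gradF => //.
    apply: measurable_coordD; first exact: measurable_coord_cst.
    by apply: measurable_coordZ => //; exact: measurable_coord_cst.
  exact: measurable_coord_cst.
- by move=> p; rewrite lee_fin sqr_ge0.
- by move=> t; exact: (second_moment_dotv (x + (t : R) *: v) v).
- by apply/measurable_EFinP/measurable_funX; exact: measurable_funB.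
- by move=> w; rewrite lee_fin sqr_ge0.
- by move=> w; exact: increment_sqr_le.
Qed.

(** Jensen gives the constant [sqrt C]; [1 + C] dominates it and avoids the root. *)
Lemma objective_lipschitz x y :
  `|objective P F x - objective P F y| <= (1 + C) * norm2 (x - y).
Proof.
have C0 := second_moment_ge0.
have mD : measurable_fun setT (fun w => F (y + (x - y)) w - F y w) by exact: measurable_funB.
have := Rintegral_sqr_le mD (increment_second_moment y (x - y)).
rewrite RintegralB// subrKC -!objectiveE => h.
rewrite -ler_sqr ?nnegrE ?mulr_ge0 ?norm2_ge0//; last lra.
rewrite real_normK ?num_real//; apply: le_trans h _.
rewrite exprMn ler_wpM2r ?sqr_ge0//; have := sqr_ge0 C; rewrite sqrrD; lra.
Qed.

(** Along a null sequence [u], the difference quotients converge for every sample, and their second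
    moments are at most [C * |v| ^ 2] since the factor [u k] cancels in [increment_second_moment].
    This replaces the pathwise domination usual in differentiation under the integral. *)
Lemma is_derive_objective x v :
  is_derive x v (objective P F) (dotv (mean_gradF P F x) v).
Proof.
apply: is_derive_cvg; apply/cvgr_dnbhsP => u [u0 ucvg].
pose Y k w := (u k)^-1 * (F (u k *: v + x) w - F x w).
have mY k : measurable_fun setT (Y k).
  by apply: measurable_funM => //; exact: measurable_funB.
have -> : (fun k => (u k)^-1 *: ((objective P F \o shift x) (u k *: v) - objective P F x)) =
    (fun k => \int[P]_w Y k w).
  apply/funext => k; rewrite /Y RintegralZl//; last exact: (integrableB measurableT (iF _) (iF _)).
  by rewrite RintegralB// -!objectiveE.
rewrite -Rintegral_dotv.
apply: (cvg_mean_of_second_moment (K := C * norm2 v ^+ 2)) => //.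
- exact: measurable_dotv_gradF.
- move=> w; have [dg <-] := is_derive_gradF w x v.
  by move/cvgr_dnbhsP: dg; apply.
- move=> k; have h := increment_second_moment x (u k *: v).
  under eq_integral => w _ do rewrite /Y exprMn EFinM.
  rewrite ge0_integralZl//; last 3 first.
  + by apply/measurable_EFinP/measurable_funX; exact: measurable_funB.
  + by move=> w _; rewrite lee_fin sqr_ge0.
  + by rewrite lee_fin sqr_ge0.
  rewrite addrC in h; apply: le_trans (lee_wpmul2l _ h) _; first by rewrite lee_fin sqr_ge0.
  rewrite -EFinM lee_fin norm2Z exprMn real_normK ?num_real//.
  have -> : (u k)^-1 ^+ 2 * (C * (u k ^+ 2 * norm2 v ^+ 2)) = C * norm2 v ^+ 2.
    by field; exact: u0.
  exact: lexx.
- exact: second_moment_dotv.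
Qed.

Lemma gradient_objective x : gradient (objective P F) x = mean_gradF P F x.
Proof.
apply/rowP => i; rewrite mxE.
have [_ ->] := is_derive_objective x (delta_mx 0 i).
rewrite /dotv (bigD1 i)//= big1 ?addr0.
  by rewrite [delta_mx _ _ _ _]mxE !eqxx mulr1.
by move=> j ji; rewrite [delta_mx _ _ _ _]mxE (negPf ji) andbF mulr0.
Qed.

Lemma objective_descent (L : R) x v :
  (forall x y, norm2 (mean_gradF P F x - mean_gradF P F y) <= L * norm2 (x - y)) ->
  objective P F (x + v) <=
    objective P F x + dotv (mean_gradF P F x) v + L / 2 * norm2 v ^+ 2.
Proof.
move=> hL; set g := mean_gradF P F x.
(* [phi] is the objective along the segment minus its quadratic model, up to a constant. By
   Cauchy-Schwarz and the Lipschitz bound its derivative is at most 0 for [t >= 0], so the mean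
   value theorem gives [phi 1 <= phi 0]. *)
pose phi (t : R) := objective P F (x + t *: v) - (dotv g v * t + L / 2 * norm2 v ^+ 2 * t ^+ 2).
pose dphi (t : R) := dotv (mean_gradF P F (x + t *: v)) v - (dotv g v + L * norm2 v ^+ 2 * t).
have hphi t : is_derive t (1 : R) phi (dphi t).
  have h1 := @is_derive_line R _ _ x v t _ (is_derive_objective (x + t *: v) v).
  apply: is_deriveB.
  apply: is_derive_eq.
  by rewrite /GRing.scale/= ?mulr1 ?mulr0; field.
have dphi0 t : 0 <= t -> dphi t <= 0.
  move=> t0; rewrite /dphi opprD addrA -dotvNl -dotvDl subr_le0.
  apply: (le_trans (ler_norm _)); apply: (le_trans (norm_dotv _ _)).
  apply: (@le_trans _ _ (L * norm2 (x + t *: v - x) * norm2 v)).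
    by apply: ler_wpM2r; [exact: norm2_ge0|exact: hL].
  by rewrite (addrC x) addrK norm2Z ger0_norm// le_eqVlt; apply/orP; left; apply/eqP; ring.
have [c] : exists2 c, c \in `]0, 1[%R & phi 1 - phi 0 = dphi c * (1 - 0).
  apply: MVT => //.
  apply: derivable_within_continuous => t _.
  by have [] := hphi t.
rewrite in_itv/= => /andP[c0 _]; rewrite subr0 mulr1 => h.
have := dphi0 c (ltW c0); rewrite -h /phi scale1r scale0r addr0.
by rewrite expr1n expr0n/= !mulr0 !mulr1 !addr0 subr0; lra.
Qed.

End SmoothObjective.

(** * Independence of the past and the fresh sample *)

Section Freezing.
Context (R : realType) (d1 d2 d3 : measure_display)
  (S : measurableType d1) (T : measurableType d2) (T' : measurableType d3)
  (P : probability T R) (P' : probability T' R)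
  (p : {mfun T' >-> S}) (V : {mfun T' >-> T}).
Hypothesis pV : forall (A : set S) (B : set T), measurable A -> measurable B ->
  P' (p @^-1` A `&` V @^-1` B) = (P' (p @^-1` A) * P B)%E.

Let mpair : measurable_fun setT (fun w => (p w, V w)).
Proof. exact: measurable_fun_pair. Qed.

Let joint : {mfun T' >-> (S * T)%type} := mfun_Sub (mem_set mpair).

(** Rectangles determine the law of the pair, and on them independence gives the product measure. *)
Let joint_law (X : set (S * T)) : measurable X ->
  (distribution P' p \x P)%E X = distribution P' joint X.
Proof.
apply: product_measure_unique => A B mA mB.
by rewrite /distribution/= /pushforward/= -pV.
Qed.

Let Q : probability S R := distribution P' p.

Let integral_law (G : S -> \bar R) : measurable_fun setT G -> (forall q, 0 <= G q)%E ->
  (\int[Q]_q G q = \int[P']_w G (p w))%E.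
Proof.
move=> mG G0.
have := @ge0_integral_pushforward _ _ _ _ R p (@measurable_funPT _ _ _ _ p) P' setT G
  measurableT mG (fun q _ => G0 q).
by rewrite preimage_setT.
Qed.

Let freezing_law (H : S * T -> \bar R) : measurable_fun setT H -> (forall q, 0 <= H q)%E ->
  (\int[P']_w H (p w, V w) = \int[Q]_q \int[P]_t H (q, t))%E.
Proof.
move=> mH H0.
have := @ge0_integral_pushforward _ _ _ _ R joint mpair P' setT H measurableT mH
  (fun q _ => H0 q).
rewrite preimage_setT => <-.
rewrite -[RHS](fubini_tonelli1 H mH H0).
by apply: eq_measure_integral => A mA _; exact/esym/joint_law.
Qed.

(** Because the pair has a product law, Tonelli integrates [V] out with [p] held fixed; this stands
    in for conditioning on [p]. *)
Lemma freezing_ge0 (H : S * T -> \bar R) : measurable_fun setT H ->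
  (forall q, 0 <= H q)%E ->
  (\int[P']_w H (p w, V w) = \int[P']_w \int[P]_t H (p w, t))%E.
Proof.
move=> mH H0; rewrite freezing_law// integral_law//.
  exact: (measurable_fun_fubini_tonelli_F H mH H0).
by move=> q; apply: integral_ge0 => t _.
Qed.

Lemma freezing (H : S * T -> \bar R) : measurable_fun setT H ->
  P'.-integrable setT (fun w => H (p w, V w)) ->
  (\int[P']_w H (p w, V w) = \int[P']_w \int[P]_t H (p w, t))%E.
Proof.
move=> mH /integrableP[mHpV iHpV].
(* The non-negative case applied to [|H|] transfers integrability from the sample space to the
   product measure. *)
have iH : (Q \x P)%E.-integrable setT H.
  apply/(integrable12ltyP Q P mH).
  by rewrite -(freezing_law (H := fun q => `|H q|%E))//; exact: measurableT_comp.
have := @integral_pushforward _ _ _ _ R joint mpair P' setT H mH.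
rewrite preimage_setT => /(_ _ measurableT) <-; last exact/integrableP.
transitivity (\int[Q \x P]_q H q)%E.
  by apply: eq_measure_integral => A mA _; exact/esym/joint_law.
rewrite -integral12_prod_meas1//.
have /integrableP[mF iF] := integrable_fubini_F iH.
have := @integral_pushforward _ _ _ _ R p (@measurable_funPT _ _ _ _ p) P' setT
  (fubini_F P H) mF.
rewrite preimage_setT => /(_ _ measurableT) <- //.
apply/integrableP; split; first exact: measurableT_comp mF _.
by rewrite -(integral_law (G := fun q => `|fubini_F P H q|%E))//; exact: measurableT_comp.
Qed.

End Freezing.

Section Past.
Context (R : realType) (dT dT' : measure_display) (T : measurableType dT)
  (T' : measurableType dT') (P : probability T R) (P' : probability T' R)
  (W : nat -> {RV P' >-> T}).
Hypothesis W_iid : iid_samples P W.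

Lemma iid_prefix (A : nat -> set T) n : (forall i, measurable (A i)) ->
  P' (\big[setI/setT]_(i < n) (W i @^-1` A i)) = (\prod_(i < n) P (A i))%E.
Proof.
move=> mA; have [Wlaw Wind] := W_iid.
have := Wind [fset i | i in iota 0 n]%fset A mA.
rewrite (_ : [set` [fset i | i in iota 0 n]%fset] = `I_n); last first.
  by apply/seteqP; split => i /=; rewrite !inE mem_iota add0n.
rewrite -(bigcap_mkord n (fun i => W i @^-1` A i)) => ->.
have -> : (\prod_(i < n) P (A i) = \prod_(i <- iota 0 n) P (A i))%E.
  by rewrite -[in RHS](subn0 n) big_mkord.
rewrite (perm_big (iota 0 n)).
  by apply: eq_bigr => i _; exact: Wlaw.
by apply: uniq_perm; [exact: fset_uniq|exact: iota_uniq|move=> i; rewrite !inE].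
Qed.

(** A pi-system generating the sigma-algebra of the first [n] samples, so that independence need
    only be checked on it. *)
Definition cylinders n : set (set T') :=
  [set A | exists2 B : nat -> set T, (forall i, measurable (B i)) &
     A = \big[setI/setT]_(i < n) (W i @^-1` B i)].

(* The sample space of [P'] with the coarser sigma-algebra of the first [n]
   samples. *)
Definition past n := g_sigma_algebraType (cylinders n).

Lemma cylinders_measurable n : cylinders n `<=` measurable.
Proof.
move=> _ [B mB ->]; apply: bigsetI_measurable => i _.
by rewrite -[X in measurable X]setTI; exact: (@measurable_funPT _ _ _ _ (W i)).
Qed.

Lemma past_sub n : <<s cylinders n >> `<=` measurable.
Proof. exact: (smallest_sub (@sigma_algebra_measurable _ T') (@cylinders_measurable n)). Qed.

Lemma measurable_past_id n : measurable_fun setT (id : T' -> past n).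
Proof. by move=> _ A mA; rewrite setTI preimage_id; exact: (@past_sub n A mA). Qed.

Lemma cylinders_setI n : setI_closed (cylinders n).
Proof.
move=> _ _ [A mA ->] [B mB ->]; exists (fun i => A i `&` B i).
  by move=> i; exact: measurableI.
by rewrite -big_split.
Qed.

Lemma cylindersT n : cylinders n setT.
Proof. by exists (fun=> setT) => //; rewrite big1. Qed.

Lemma measurable_past_sample n i : (i < n)%N ->
  measurable_fun setT (W i : past n -> T).
Proof.
move=> ilt _ B mB; rewrite setTI; apply: sub_sigma_algebra.
exists (fun j => if j == i then B else setT); first by move=> j; case: ifP.
rewrite (bigD1 (Ordinal ilt))//= eqxx big1 ?setIT// => j ji.
by rewrite ifF ?preimage_setT//; apply/negbTE.
Qed.

(** As functions of [A], both sides are finite measures; they agree on the pi-system of cylinders,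
    hence on the generated sigma-algebra. *)
Lemma past_independent n (A : set T') (B : set T) :
  <<s cylinders n >> A -> measurable B ->
  P' (A `&` W n @^-1` B) = (P' A * P B)%E.
Proof.
move=> sA mB; have [Wlaw _] := W_iid.
have mWB : measurable (W n @^-1` B).
  by rewrite -[X in measurable X]setTI; exact: (@measurable_funPT _ _ _ _ (W n)).
have PB0 : 0 <= fine (P B) by rewrite fine_ge0.
pose m1 := mrestr P' mWB : {measure set T' -> \bar R}.
pose m2 := mscale (NngNum PB0) P' : {measure set T' -> \bar R}.
have cover : \bigcup_(k in [set: nat]) [set: T'] = setT.
  by apply/seteqP; split => // w _; exists 0%N.
have := @g_sigma_algebra_measure_unique _ R T' (cylinders n)
  (@cylinders_measurable n) (fun=> setT) (fun=> @cylindersT n) cover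
  m1 m2 (@cylinders_setI n).
move=> /(_ _ _ A sA); rewrite /m1 /m2 /= /mrestr /mscale/= fineK ?fin_num_measure// muleC.
apply.
(* A cylinder of length [n] intersected with an event on [W n] is a cylinder of length [n.+1], to
   which the product formula applies. *)
- move=> _ [C mC ->]; pose D i := if i == n then B else C i.
  have mD i : measurable (D i) by rewrite /D; case: ifP.
  have e : \big[setI/setT]_(i < n) (W i @^-1` C i) =
      \big[setI/setT]_(i < n) (W i @^-1` D i).
    by apply: eq_bigr => i _; rewrite /D ltn_eqF.
  have := iid_prefix n.+1 mD; rewrite big_ord_recr/= {2}/D eqxx e => ->.
  by rewrite big_ord_recr/= -(iid_prefix n mD) /D eqxx muleC.
- move=> _; rewrite setTI; apply: le_lt_trans (probability_le1 P' mWB) _.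
  exact: ltry.
Qed.

End Past.

(** * Series with bounded partial sums *)

Section BoundedSums.
Context (R : realType).
Implicit Types (u v w : nat -> R).

(** A one-sided bound: for non-negative terms it is summability, while terms of either sign can
    still be compared and telescoped. *)
Definition bounded_sums u := exists B, forall n, \sum_(k < n) u k <= B.

Lemma bounded_sumsD u v : bounded_sums u -> bounded_sums v ->
  bounded_sums (fun k => u k + v k).
Proof.
move=> [A hA] [B hB]; exists (A + B) => n.
by rewrite big_split lerD.
Qed.

Lemma bounded_sumsZ c u : 0 <= c -> bounded_sums u ->
  bounded_sums (fun k => c * u k).
Proof.
by move=> c0 [A hA]; exists (c * A) => n; rewrite -mulr_sumr ler_wpM2l.
Qed.

Lemma bounded_sums_tail N u : bounded_sums (fun k => u (N + k)%N) ->
  bounded_sums u.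
Proof.
move=> [B hB]; exists (\sum_(k < N) `|u k| + `|B|) => n.
have [nN|/ltnW Nn] := leqP n N.
  apply: ler_wpDr => //; rewrite -(subnKC nN) big_split_ord/=.
  by apply: ler_wpDr; [exact: sumr_ge0|apply: ler_sum => k _; exact: ler_norm].
rewrite -(subnKC Nn) big_split_ord/= lerD//.
  by apply: ler_sum => k _; exact: ler_norm.
by rewrite (le_trans (hB _))// ler_norm.
Qed.

Lemma bounded_sums_le u v N : (forall k, 0 <= v k) ->
  (forall k, (N <= k)%N -> u k <= v k) -> bounded_sums v -> bounded_sums u.
Proof.
move=> v0 uv [B hB]; apply: (bounded_sums_tail (N := N)); exists B => n.
apply: le_trans (hB (N + n)%N); rewrite big_split_ord/=.
apply: ler_wpDl; first exact: sumr_ge0.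
by apply: ler_sum => k _; rewrite uv// leq_addr.
Qed.

Lemma bounded_sums_telescope u w N : (forall k, (N <= k)%N -> 0 <= w k) ->
  (forall k, (N <= k)%N -> u k <= w k - w k.+1) -> bounded_sums u.
Proof.
move=> w0 uw; apply: (bounded_sums_tail (N := N)); exists (w N) => n.
apply: (@le_trans _ _ (w N - w (N + n)%N)); last first.
  by rewrite gerBl w0// leq_addr.
elim: n => [|n IHn]; first by rewrite big_ord0 addn0 subrr.
rewrite big_ord_recr/= (le_trans (lerD IHn (uw _ (leq_addr _ _))))//.
by rewrite addnS subrKA.
Qed.

Lemma bounded_sums_Cauchy u : (forall k, 0 <= u k) -> bounded_sums u ->
  forall e, 0 < e -> exists N, forall n, \sum_(k < n) u (N + k)%N <= e.
Proof.
move=> u0 [B hB] e e0; pose S := range (fun n => \sum_(k < n) u k).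
have hS : has_sup S.
  split; first by exists (\sum_(k < 0) u k); exists 0%N.
  by exists B => _ [n _ <-].
have [_ [N _ <-] hN] := sup_adherent e0 hS; exists N => n.
have : \sum_(k < N + n) u k <= sup S.
  by apply: ub_le_sup; [case: hS | exists (N + n)%N].
by rewrite big_split_ord/=; lra.
Qed.

(** Summing the descent gives [\sum a * y < oo], and [y ^ 2] has summable upward increments. As
    [\sum a] diverges, [y] falls to [eps / 2] or below at some late index, after which [y ^ 2] stays
    at most [(eps / 2) ^ 2 + eps ^ 2 / 2], which is less than [eps ^ 2]. *)
Lemma cvg0_of_descent (a y e b : nat -> R) (K m : R) :
  (forall k, 0 < a k) -> (forall k, 0 <= y k) -> (forall k, m <= e k) ->
  (forall B, exists n, B <= \sum_(k < n) a k) ->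
  bounded_sums (fun k => a k ^+ 2) -> bounded_sums b ->
  (forall k, a k * y k <= e k - e k.+1 + b k) ->
  (forall k, `|y k.+1 - y k| <= K * a k) ->
  y @ \oo --> 0.
Proof.
move=> a0 y0 me aoo a2 hb ay dy.
have K0 : 0 <= K.
  by rewrite -(pmulr_lge0 _ (a0 0%N)); apply: le_trans (dy 0%N).
have hay : bounded_sums (fun k => a k * y k).
  (* The comparison needs a non-negative majorant, hence the maximum with 0. *)
  apply: (bounded_sums_le (N := 0%N) (v := fun k => Num.max (e k - e k.+1 + b k) 0)).
  - by move=> k; rewrite le_max lexx orbT.
  - by move=> k _; rewrite le_max ay.
  have : bounded_sums (fun k => (e k - m) - (e k.+1 - m) + b k).
    apply: bounded_sumsD => //.
    by apply: (bounded_sums_telescope (w := fun k => e k - m) (N := 0%N)) => k _; rewrite ?subr_ge0.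
  move=> [B hB]; exists B => n; apply: le_trans (hB n).
  apply: ler_sum => k _; rewrite ge_max; apply/andP; split; first lra.
  by have := mulr_ge0 (ltW (a0 k)) (y0 k); have := ay k; lra.
(* This is [(y k + K * a k) ^ 2 - y k ^ 2], a bound on the rise of [y ^ 2] in one step; it combines
   the summable [a * y] and [a ^ 2]. *)
pose c k := K * a k * (2 * y k + K * a k).
have c0 k : 0 <= c k.
  by rewrite /c; have := mulr_ge0 K0 (ltW (a0 k)) => h; rewrite mulr_ge0// addr_ge0// mulr_ge0.
have hc : bounded_sums c.
  have hs := bounded_sumsD (bounded_sumsZ (mulr_ge0 (ler0n R 2) K0) hay)
    (bounded_sumsZ (mulr_ge0 K0 K0) a2).
  apply: (bounded_sums_le (N := 0%N) _ _ hs) => [i|i _].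
    by rewrite addr_ge0// mulr_ge0// ?mulr_ge0// ?sqr_ge0// ltW.
  by rewrite /c; lra.
have yc k : y k.+1 ^+ 2 <= y k ^+ 2 + c k.
  have := dy k; rewrite ler_norml => /andP[_]; rewrite lerBlDl => h.
  have : y k.+1 ^+ 2 <= (y k + K * a k) ^+ 2.
    have h' := mulr_ge0 K0 (ltW (a0 k)).
    by rewrite ler_sqr ?nnegrE// addr_ge0.
  by rewrite /c; lra.
apply/cvgrPdist_lt => eps eps0.
have [//|N hN] := bounded_sums_Cauchy c0 hc (e := eps ^+ 2 / 2); first by rewrite divr_gt0// exprn_gt0.
have [j [Nj yj]] : exists j, (N <= j)%N /\ y j <= eps / 2.
  apply: contrapT => /forallNP hj.
  have [B hB] := hay.
  (* If [y > eps / 2] from [N] on, this much mass of [a] forces [\sum a * y] up to at least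
     [B + eps / 2]. *)
  have [n hn] := aoo (\sum_(k < N) a k + 2 * B / eps + 1).
  have [nN|/ltnW Nn] := leqP n N.
    have := hB 0%N; rewrite big_ord0 => B0.
    have : 0 <= 2 * B / eps by rewrite divr_ge0 ?mulr_ge0// ltW.
    have : \sum_(k < n) a k <= \sum_(k < N) a k.
      rewrite -(subnKC nN) big_split_ord/= ler_wpDr// sumr_ge0// => *; exact: ltW.
    by lra.
  have h4 := hB n; have h3 := hn; rewrite -(subnKC Nn) !big_split_ord/= in h3 h4.
  set r := \sum_(i < n - N) a (N + i)%N in h3.
  set q := \sum_(i < n - N) _ in h4.
  have h1 : 0 <= \sum_(i < N) a i * y i.
    by apply: sumr_ge0 => *; rewrite mulr_ge0// ltW.
  have h2 : eps / 2 * r <= q.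
    rewrite mulr_sumr; apply: ler_sum => i _; rewrite mulrC ler_pM2l//.
    have /not_andP[|/negP] := hj (N + i)%N; first by rewrite leq_addr.
    by rewrite -ltNge => /ltW.
  have h5 : 2 * B / eps + 1 <= r by lra.
  have : eps / 2 * (2 * B / eps + 1) <= eps / 2 * r by rewrite ler_pM2l// divr_gt0.
  have -> : eps / 2 * (2 * B / eps + 1) = B + eps / 2 by field; rewrite gt_eqF.
  by lra.
have yjn n : y (j + n)%N ^+ 2 <= y j ^+ 2 + \sum_(k < n) c (j + k)%N.
  elim: n => [|n IHn]; first by rewrite big_ord0 addn0 addr0.
  by rewrite addnS big_ord_recr/= addrA (le_trans (yc _))// lerD2r.
have tail n : \sum_(k < n) c (j + k)%N <= eps ^+ 2 / 2.
  apply: le_trans (hN (j - N + n)%N); rewrite big_split_ord/= ler_wpDl ?sumr_ge0//.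
  by apply: ler_sum => k _; rewrite addnA subnKC.
exists j => // n /= jn; rewrite sub0r normrN ger0_norm//.
rewrite -ltr_sqr ?nnegrE// ?ltW//.
rewrite -(subnKC jn); apply: le_lt_trans (yjn _) _.
have := tail (n - j)%N.
have : y j ^+ 2 <= (eps / 2) ^+ 2 by rewrite ler_sqr// nnegrE// divr_ge0// ltW.
have : 0 < eps ^+ 2 by rewrite exprn_gt0.
by lra.
Qed.

End BoundedSums.

(** * Step sizes comparable to the increments of an iterated logarithm *)

Section LogSteps.
Context (R : realType).
Implicit Types (u g a : nat -> R) (s : nat -> nat).

(* [g] plays the role of the derivative of a concave function [u]. *)
Definition log_step u g N := forall n, (N <= n)%N ->
  [/\ 0 < g n, u n.+1 - u n <= g n & g n.+1 <= u n.+1 - u n].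

Lemma lnB_le (x y : R) : 0 < x -> 0 < y -> ln x - ln y <= (x - y) / y.
Proof.
move=> x0 y0; have -> : (x - y) / y = x / y - 1 by rewrite mulrBl divff// gt_eqF.
rewrite -ln_div ?posrE//; have xy0 : 0 < x / y by rewrite divr_gt0.
by have := expR_ge1Dx (ln (x / y)); rewrite lnK ?posrE//; lra.
Qed.

Lemma lnB_ge (x y : R) : 0 < x -> 0 < y -> (x - y) / x <= ln x - ln y.
Proof.
move=> x0 y0; have := lnB_le y0 x0.
have -> : (x - y) / x = - ((y - x) / x) by rewrite -mulNr opprB.
lra.
Qed.

Lemma log_step1 : log_step (fun n => ln n%:R) (fun n => n%:R^-1) 1.
Proof.
move=> [//|n] _; split; first by rewrite invr_gt0.
- have := @lnB_le n.+2%:R n.+1%:R; rewrite -[n.+2]addn1 natrD [_ + 1 - _]addrC addKr div1r.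
  by apply.
- have := @lnB_ge n.+2%:R n.+1%:R; rewrite -[n.+2]addn1 natrD [_ + 1 - _]addrC addKr div1r.
  by apply.
Qed.

(** A discrete chain rule: [ln x - ln y] lies between [(x - y) / x] and [(x - y) / y]. Iterated from
    [ln n], it yields [ln (ln n)] and [ln (ln (ln n))]. *)
Lemma log_step_ln u g N : log_step u g N -> (forall n, (N <= n)%N -> 1 <= u n) ->
  log_step (fun n => ln (u n)) (fun n => g n / u n) N.
Proof.
move=> ug u1 n Nn; have [g0 h1 h2] := ug n Nn.
have u0 m : (N <= m)%N -> 0 < u m by move=> /u1; apply: lt_le_trans.
split; first by rewrite divr_gt0// u0.
- apply: le_trans (lnB_le _ _) _; rewrite ?u0//; last by rewrite ler_pM2r// invr_gt0 u0.
  exact: leqW.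
- apply: le_trans (lnB_ge _ _); rewrite ?u0//; last by rewrite leqW.
  by rewrite ler_pM2r// invr_gt0 u0// leqW.
Qed.

Lemma log_step_ndecr u g N : log_step u g N ->
  forall m n, (N <= m)%N -> (m <= n)%N -> u m <= u n.
Proof.
move=> ug m n Nm mn; rewrite -(subnKC mn); elim: (n - m)%N => [|i IHi].
  by rewrite addn0.
rewrite addnS (le_trans IHi)//.
have [//|_ _ h] := ug (m + i)%N; first by rewrite (leq_trans Nm)// leq_addr.
have [//|h' _ _] := ug (m + i).+1; first by rewrite (leq_trans Nm)// leqW// leq_addr.
lra.
Qed.

Lemma log_step_sum u g N : log_step u g N -> forall m n, (N <= m)%N ->
  (m <= n)%N ->
  u n.+1 - u m.+1 <= \sum_(m <= k < n) g k.+1 <= u n - u m.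
Proof.
move=> ug m n Nm mn; rewrite -(subnKC mn); elim: (n - m)%N => [|i /andP[h1 h2]].
  by rewrite addn0 big_geq// !subrr lexx.
have Ni : (N <= m + i)%N by rewrite (leq_trans Nm)// leq_addr.
rewrite addnS big_nat_recr ?leq_addr//=.
have [_ _ k2] := ug (m + i)%N Ni; have [_ k1 _] := ug (m + i).+1 (leqW Ni).
by apply/andP; split; lra.
Qed.

(** Here [u] is the logarithm of the [u] of the overview, so that [expR (- b * u n)] is its power of
    exponent [- b]. The sequence [v] below behaves like a Riemann sum of [expR (- b * u)] against
    [du], hence is summable; up to constants it dominates the squares and the delayed products. *)
Lemma log_step_conditions u g a s N (c K b : R) :
  log_step u g N -> (forall B, exists n, (N <= n)%N /\ B <= u n) ->
  0 < c -> 0 < b ->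
  (forall n, (N <= n)%N -> [/\ a n = c * g n, 0 <= u n, g n <= 1 &
    g n <= expR (- b * u n)]) ->
  (forall n, (s n <= n)%N) ->
  (exists M, forall n, (M <= n)%N ->
    (N <= s n)%N /\ u n - u (s n) <= K * expR (- b * u (s n))) ->
  [/\ forall B, exists n, B <= \sum_(k < n) a k.+1,
      bounded_sums (fun k => a k.+1 ^+ 2) &
      bounded_sums (fun k => a k.+1 * \sum_(s k <= r < k) a r.+1)].
Proof.
move=> ug uoo c0 b0 hg sn [M hM].
have ndu := log_step_ndecr ug.
have g0 n : (N <= n)%N -> 0 < g n by case/ug.
pose v k := g k.+1 * expR (- b * u k).
have hv : bounded_sums v.
  (* For [D = u k.+1 - u k] in [[0, 1]], [1 - expR (- b * D) >= b * D * expR (- b * D) >= b * D *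
     expR (- b)]; this explains the factor [expR b / b]. *)
  apply: (bounded_sums_telescope (w := fun k => expR b / b * expR (- b * u k)) (N := N)) => k Nk.
    by rewrite mulr_ge0 ?expR_ge0// divr_ge0 ?expR_ge0// ltW.
  have [_ k1 k2] := ug k Nk; have [_ _ g1 _] := hg k Nk.
  have gk := g0 k.+1 (leqW Nk).
  set D := u k.+1 - u k in k1 k2.
  have D0 : 0 <= D by lra.
  have D1 : D <= 1 by lra.
  have -> : u k.+1 = u k + D by rewrite /D; lra.
  rewrite /v mulrDr expRD; set p := expR (- b * u k); set q := expR (- b * D).
  have -> : expR b / b * p - expR b / b * (p * q) = expR b / b * (1 - q) * p by ring.
  rewrite ler_pM2r ?expR_gt0//.
  have h1 : 1 + b * D <= expR (b * D) := expR_ge1Dx _.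
  have h2 : expR (- b * D) * (1 + b * D) <= 1.
    rewrite mulNr expRN mulrC ler_pdivrMr ?expR_gt0// mul1r//.
  have h3 : expR (- b * D) * expR b >= 1.
    by rewrite -expRD; apply: le_trans (expR_ge1Dx _); rewrite lerDl mulNr addrC subr_ge0 ler_piMr// ltW.
  apply: (@le_trans _ _ D) => //.
  have h4 : expR (- b * D) * (b * D) <= 1 - expR (- b * D) by lra.
  have h5 : expR b / b * (expR (- b * D) * (b * D)) <= expR b / b * (1 - expR (- b * D)).
    by rewrite ler_pM2l// divr_gt0// expR_gt0.
  apply: le_trans h5.
  have -> : expR b / b * (expR (- b * D) * (b * D)) = (expR (- b * D) * expR b) * D.
    by field; rewrite gt_eqF.
  by rewrite ler_peMl.
have v0 k : (N <= k)%N -> 0 <= v k.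
  by move=> Nk; rewrite mulr_ge0 ?expR_ge0// ltW// g0// leqW.
(* Below [N] nothing is known of the sign of [v]; clipping at 0 provides a non-negative majorant. *)
have hv' : bounded_sums (fun k => Num.max 0 (v k)).
  apply: (bounded_sums_tail (N := N)); have [B hB] := hv.
  exists (B + \sum_(k < N) `|v k|) => n; rewrite addrC -lerBlDl.
  apply: le_trans (hB (N + n)%N); rewrite big_split_ord/= lerBlDl addrA ler_wpDl//.
    rewrite -big_split sumr_ge0// => k _ /=.
    by have := ler_norm (- v k); rewrite normrN; lra.
  by apply: ler_sum => k _; rewrite max_r// v0// leq_addr.
have v'0 k : 0 <= Num.max 0 (v k) by rewrite le_max lexx.
have vv' k : v k <= Num.max 0 (v k) by rewrite le_max lexx orbT.
split.
- move=> B.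
  have [n [Nn hn]] := uoo ((B + \sum_(k < N) `|a k.+1|) / c + u N.+1).
  exists n; rewrite -(subnKC Nn) big_split_ord/=.
  have /andP[h _] := log_step_sum ug (leqnn N) Nn.
  have : c * (u n - u N.+1) <= \sum_(i < n - N) a (N + i).+1.
    rewrite (eq_bigr (fun i : 'I_(n - N) => c * g (N + i).+1)); last first.
      by move=> i _; have [->] := hg (N + i).+1 (leqW (leq_addr _ _)).
    rewrite -mulr_sumr ler_pM2l//.
    have gE : \sum_(N <= k < n) g k.+1 = \sum_(i < n - N) g (N + i).+1.
      rewrite -{1}[N]add0n big_addn big_mkord.
      by apply: eq_bigr => i _; rewrite addnC.
    rewrite -gE; by have := ndu n n.+1 Nn (leqnSn n); lra.
  have h1 : - \sum_(i < N) `|a i.+1| <= \sum_(i < N) a i.+1.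
    by rewrite -sumrN ler_sum// => i _; have := ler_norm (- a i.+1); rewrite normrN; lra.
  have : B + \sum_(k < N) `|a k.+1| <= c * (u n - u N.+1).
    by rewrite mulrC -ler_pdivrMr//; lra.
  by lra.
- apply: (bounded_sums_le (N := N) _ _ (bounded_sumsZ (sqr_ge0 c) hv')).
    by move=> k; rewrite mulr_ge0// sqr_ge0.
  move=> k Nk; have [-> _ _ ge] := hg k.+1 (leqW Nk).
  rewrite exprMn ler_wpM2l ?sqr_ge0//; apply: le_trans (vv' k).
  rewrite expr2 ler_pM2l ?g0 ?leqW//; apply: le_trans ge _.
  by rewrite ler_expR !mulNr lerN2 ler_pM2l// ndu.
(* For [K < 0] the delay bound contradicts the monotonicity of [u], so the terms beyond [maxn M N]
   are covered vacuously. *)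
- have [K0|K0] := leP 0 K; last first.
    apply: (bounded_sums_telescope (w := fun=> 0) (N := maxn M N)) => // k.
    rewrite geq_max => /andP[/hM[Ns h] Nk].
    have := ndu _ _ Ns (sn k).
    have : K * expR (- b * u (s k)) < 0 by rewrite nmulr_rlt0// expR_gt0.
    by lra.
  (* The factor [c ^+ 2] comes from the two step sizes, [expR (b * K)] from replacing [u (s k)] by
     [u k] in the exponential, since [u k - u (s k) <= K]. *)
  pose K' := c ^+ 2 * (K * expR (b * K)).
  have K'0 : 0 <= K' by rewrite mulr_ge0 ?sqr_ge0// mulr_ge0// expR_ge0.
  apply: (bounded_sums_le (N := maxn M N) _ _ (bounded_sumsZ K'0 hv')).
    by move=> k; rewrite mulr_ge0.
  move=> k; rewrite geq_max => /andP[/hM[Ns h] Nk].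
  apply: (@le_trans _ _ (K' * v k)); last by rewrite ler_wpM2l.
  have [-> _ _ _] := hg k.+1 (leqW Nk).
  have -> : \sum_(s k <= r < k) a r.+1 = c * \sum_(s k <= r < k) g r.+1.
    rewrite mulr_sumr; apply: eq_big_nat => r /andP[sr _].
    by have [->] := hg r.+1 (leqW (leq_trans Ns sr)).
  rewrite /K' /v; set S := \sum_(s k <= r < k) _.
  have -> : c * g k.+1 * (c * S) = c ^+ 2 * (g k.+1 * S) by ring.
  rewrite -mulrA ler_wpM2l ?sqr_ge0// mulrCA ler_pM2l ?g0 ?leqW//.
  have us0 : 0 <= u (s k) by have [] := hg _ Ns.
  have e1 : expR (- b * u (s k)) <= 1 by rewrite -expR0 ler_expR mulNr oppr_le0 mulr_ge0// ltW.
  have uK : u k - u (s k) <= K by apply: (le_trans h); rewrite ler_piMr.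
  have /andP[_ hS] := log_step_sum ug Ns (sn k).
  apply: le_trans hS _; apply: le_trans h _.
  rewrite -mulrA ler_wpM2l// -expRD ler_expR.
  have : b * (u k - u (s k)) <= b * K by rewrite ler_pM2l.
  by lra.
Qed.

End LogSteps.

(** * The delay and step-size conditions *)

Section DelayConditions.
Context (R : realType) (s : nat -> nat) (a : nat -> R).
Hypothesis s_le : forall n, (s n <= n)%N.
Hypothesis s_finite : finite_delays R s.
Hypothesis a_gt0 : forall n, (0 < n)%N -> 0 < a n.

(** All that the analysis of the iterates retains of (D1)-(D4). The third sum measures staleness:
    its inner sum bounds, on average and up to a constant, the distance from [X (s k)] to [X k]. *)
Definition summable_delayed_steps :=
  [/\ forall B, exists n, B <= \sum_(k < n) a k.+1,
      bounded_sums (fun k => a k.+1 ^+ 2) &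
      bounded_sums (fun k => a k.+1 * \sum_(s k <= r < k) a r.+1)].

Lemma delay_ge n : (n - s n)%:R <= delay R s (s n).
Proof. by apply: ub_le_sup; [exact: s_finite | exists n]. Qed.

(** A source with finite delay is received only finitely often, so every fixed value is eventually
    left behind. *)
Lemma source_unbounded N : exists M, forall n, (M <= n)%N -> (N <= s n)%N.
Proof.
elim: N => [|N [M hM]]; first by exists 0%N.
have [B hB] := s_finite N.
exists (maxn M (N + Num.truncn B).+1) => n; rewrite geq_max => /andP[/hM].
rewrite leq_eqVlt => /predU1P[Ns|//] nB.
have : (n - N)%N%:R <= B by apply: hB; exists n.
have B0 : 0 <= B.
  by apply: le_trans (ler0n _ (n - N)) _; apply: hB; exists n.
rewrite -truncn_ge_nat// leq_subLR => /(leq_trans nB).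
by rewrite ltnn.
Qed.

Lemma delay_bigO (g : nat -> R) N : delay R s =O_\oo g ->
  (forall n, (N <= n)%N -> 0 <= g n) ->
  exists C M, 0 < C /\ forall n, (M <= n)%N ->
    (N <= s n)%N /\ n%:R <= (s n)%:R + C * g (s n).
Proof.
move=> /eqO_exP[C C0 [N1 _ hC]] g0.
have [M hM] := source_unbounded (maxn N N1).
exists C, M; split=> // n /hM; rewrite geq_max => /andP[Ns /hC /= h].
split=> //; rewrite -lerBlDl -natrB//.
apply: le_trans (delay_ge n) _; apply: le_trans (ler_norm _) _.
by rewrite (ger0_norm (g0 _ Ns)) in h.
Qed.

Lemma ln_unbounded (u : nat -> R) N : (forall B, exists n, (N <= n)%N /\ B <= u n) ->
  forall B, exists n, (N <= n)%N /\ B <= ln (u n).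
Proof.
move=> uoo B; have [n [Nn hn]] := uoo (expR B); exists n; split=> //.
by rewrite -[B]expRK ler_ln ?posrE ?expR_gt0// (lt_le_trans (expR_gt0 B)).
Qed.

Lemma natr_unbounded N (B : R) : exists n, (N <= n)%N /\ B <= n%:R.
Proof.
exists (maxn N (Num.truncn B).+1); split; first exact: leq_maxl.
by rewrite (le_trans (ltW (truncnS_gt B)))// ler_nat leq_maxr.
Qed.

Lemma ln_eventually_ge (u : nat -> R) N1 (B : R) :
  (forall m n, (N1 <= m)%N -> (m <= n)%N -> u m <= u n) ->
  (forall C, exists n, (N1 <= n)%N /\ C <= u n) ->
  exists2 N, (N1 <= N)%N & forall n, (N <= n)%N -> B <= u n.
Proof.
move=> ndu uoo; have [N [NN hN]] := uoo B; exists N => // n Nn.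
exact: le_trans (ndu _ _ NN Nn).
Qed.

Lemma log_step_shift (u g : nat -> R) N N' : (N <= N')%N -> log_step u g N -> log_step u g N'.
Proof. by move=> NN ug n Nn; apply: ug; exact: leq_trans Nn. Qed.

(** For [k = s n], [ln n - ln k <= (n - k) / k <= C * k ^ (p - 1)], which is
    [C * expR (- (1 - p) * ln k)]: hence [b = 1 - p]. *)
Lemma sublinear_summable : sublinear_delays s a -> summable_delayed_steps.
Proof.
move=> [[p [p0 p1 hO]] [c c0 ac]].
have [|C [M [C0 hM]]] := delay_bigO (N := 1%N) hO; first by move=> *; exact: powR_ge0.
apply: (log_step_conditions (c := c) (b := 1 - p) (K := C) (@log_step1 R)) => //.
- by apply: ln_unbounded => B; exact: natr_unbounded.
- by rewrite subr_gt0.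
- move=> n n1; have n0 : 0 < n%:R :> R by rewrite ltr0n.
  have n1' : 1 <= n%:R :> R by rewrite ler1n.
  have l0 : 0 <= ln (n%:R : R) by rewrite ln_ge0.
  split=> //.
  + by rewrite ac ?div1r// invr_gt0.
  + by rewrite invf_le1.
  + rewrite -[n%:R in leLHS]lnK ?posrE// -expRN ler_expR mulNr lerN2.
    by rewrite ler_piMl//; lra.
- exists M => n /hM[sn hn]; split=> //.
  have k0 : 0 < (s n)%:R :> R by rewrite ltr0n.
  have n0 : 0 < n%:R :> R by rewrite ltr0n (leq_trans sn).
  apply: le_trans (lnB_le n0 k0) _.
  apply: (@le_trans _ _ (C * (s n)%:R `^ p / (s n)%:R)).
    by rewrite ler_pM2r ?invr_gt0//; lra.
  rewrite -mulrA (ler_wpM2l (ltW C0))// /powR gt_eqF//.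
  rewrite -[X in _ / X](lnK (x := (s n)%:R)) ?posrE// -expRN -expRD ler_expR.
  by lra.
Qed.

Lemma log2_step : exists2 N, (1 <= N)%N &
  [/\ log_step (fun n => ln (ln (n%:R : R))) (fun n => n%:R^-1 / ln n%:R) N,
      (forall n, (N <= n)%N -> 1 <= ln (n%:R : R)) &
      forall B : R, exists n, (N <= n)%N /\ B <= ln n%:R].
Proof.
have l1 := @log_step1 R.
have loo N (B : R) : exists n, (N <= n)%N /\ B <= ln n%:R.
  by apply: ln_unbounded => B'; exact: natr_unbounded.
have [N N1 hN] := ln_eventually_ge 1 (log_step_ndecr l1) (loo 1%N).
by exists N => //; split => //; apply: log_step_ln => //; exact: log_step_shift l1.
Qed.

Lemma log3_step : exists2 N, (1 <= N)%N &
  [/\ log_step (fun n => ln (ln (ln (n%:R : R)))) (fun n => n%:R^-1 / ln n%:R / ln (ln n%:R)) N,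
      (forall n, (N <= n)%N -> 1 <= ln (n%:R : R) /\ 1 <= ln (ln (n%:R : R))) &
      forall B : R, exists n, (N <= n)%N /\ B <= ln (ln n%:R)].
Proof.
have [N1 N11 [l2 h1 loo]] := log2_step.
have lloo := ln_unbounded loo.
have [N NN hN] := ln_eventually_ge 1 (log_step_ndecr l2) lloo.
exists N; first exact: leq_trans NN.
split.
- by apply: log_step_ln => //; exact: log_step_shift l2.
- by move=> n Nn; split; [apply: h1; exact: leq_trans Nn | exact: hN].
- move=> B; have [n [Nn hn]] := lloo B.
  exists (maxn N n); rewrite leq_maxl; split=> //; apply: le_trans hn _.
  by apply: (log_step_ndecr l2) => //; exact: leq_maxr.
Qed.

(** With [k = s n], [n <= (1 + C) * k] gives [ln n - ln k <= ln (1 + C)], and dividing by [ln k]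
    bounds the increment of [ln (ln n)]; since [1 / ln k = expR (- ln (ln k))], [b = 1]. *)
Lemma linear_summable : linear_delays s a -> summable_delayed_steps.
Proof.
move=> [hO [c c0 ac]].
have [N N1 [l2 hN loo]] := log2_step.
have [|C [M [C0 hM]]] := delay_bigO (N := N) hO; first by [].
apply: (log_step_conditions (c := c) (b := 1) (K := ln (1 + C)) l2) => //.
- exact: ln_unbounded.
- move=> n Nn; have n0 : 0 < n%:R :> R by rewrite ltr0n (leq_trans N1).
  have n1 : 1 <= n%:R :> R by rewrite ler1n (leq_trans N1).
  have l1 := hN n Nn; have l0 : 0 < ln (n%:R : R) by lra.
  have i1 : n%:R^-1 <= 1 :> R by rewrite invf_le1.
  split=> /=.
  + by rewrite ac -?invfM ?div1r// invr_gt0 mulr_gt0.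
  + by rewrite ln_ge0.
  + by rewrite ler_pdivrMr// mul1r; lra.
  + rewrite mulN1r expRN lnK ?posrE// ler_piMl// invr_ge0 ltW//.
- exists M => n /hM[sn hn]; split=> //.
  have k1 : 1 <= ln ((s n)%:R : R) by exact: hN.
  have k0 : 0 < (s n)%:R :> R by rewrite ltr0n (leq_trans N1).
  have n0 : 0 < n%:R :> R by rewrite ltr0n (leq_trans N1)// (leq_trans sn).
  have n1 : 1 <= ln (n%:R : R) by apply: hN; exact: leq_trans (s_le n).
  apply: le_trans (lnB_le _ _) _; [lra|lra|].
  rewrite mulN1r expRN lnK ?posrE; last lra.
  rewrite ler_pM2r ?invr_gt0; last lra.
  rewrite -ln_div ?posrE// ler_ln ?posrE ?divr_gt0//; last lra.
  by rewrite ler_pdivrMr//; lra.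
Qed.

(** One logarithm further: for [k = s n], [n <= (1 + C) * k ^ q] as [q >= 1], so
    [ln n <= (q + ln (1 + C)) * ln k] once [ln k >= 1]; the rest is as in the linear case. *)
Lemma polynomial_summable : polynomial_delays s a -> summable_delayed_steps.
Proof.
move=> [[q q1 hO] [c c0 ac]].
have [N N1 [l3 hN loo]] := log3_step.
have [|C [M [C0 hM]]] := delay_bigO (N := N) hO; first by move=> *; exact: powR_ge0.
have lC : 0 <= ln (1 + C) by rewrite ln_ge0; lra.
apply: (log_step_conditions (c := c) (b := 1) (K := ln (q + ln (1 + C))) l3) => //.
- exact: ln_unbounded.
- move=> n Nn; have n0 : 0 < n%:R :> R by rewrite ltr0n (leq_trans N1).
  have n1 : 1 <= n%:R :> R by rewrite ler1n (leq_trans N1).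
  have [l1 l1'] := hN n Nn; have l0 : 0 < ln (n%:R : R) by lra.
  have l0' : 0 < ln (ln (n%:R : R)) by lra.
  have i1 : n%:R^-1 / ln n%:R <= 1 :> R.
    by rewrite ler_pdivrMr// mul1r; apply: le_trans l1; rewrite invf_le1.
  split=> /=.
  + by rewrite ac -?invfM ?div1r// invr_gt0 !mulr_gt0.
  + by rewrite ln_ge0.
  + by rewrite ler_pdivrMr// mul1r; lra.
  + by rewrite mulN1r expRN lnK ?posrE// ler_piMl// invr_ge0 ltW.
- exists M => n /hM[sn hn]; split=> //.
  have [k1 k1'] := hN _ sn.
  have k0 : 0 < (s n)%:R :> R by rewrite ltr0n (leq_trans N1).
  have k01 : 1 <= (s n)%:R :> R by rewrite ler1n (leq_trans N1).
  have n0 : 0 < n%:R :> R by rewrite ltr0n (leq_trans N1)// (leq_trans sn).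
  have [n1 n1'] := hN _ (leq_trans sn (s_le n)).
  apply: le_trans (lnB_le _ _) _; [lra|lra|].
  rewrite mulN1r expRN lnK ?posrE; last lra.
  rewrite ler_pM2r ?invr_gt0; last lra.
  rewrite -ln_div ?posrE; [|lra|lra].
  rewrite ler_ln ?posrE ?divr_gt0//; [|lra|lra|lra].
  rewrite ler_pdivrMr; last lra.
  have kq : (s n)%:R <= (s n)%:R `^ q :> R.
    by rewrite -{1}[(s n)%:R]powRr1 ?ler_powR// ltW.
  have kq0 : 0 < (s n)%:R `^ q :> R by rewrite powR_gt0.
  have : ln (n%:R : R) <= ln ((1 + C) * (s n)%:R `^ q).
    by rewrite ler_ln ?posrE// ?mulr_gt0//; lra.
  rewrite lnM ?posrE//; last lra.
  rewrite ln_powR; have : ln (1 + C) <= ln (1 + C) * ln (s n)%:R by rewrite ler_peMr.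
  by lra.
Qed.

End DelayConditions.

Section BoundedDelays.
Context (R : realType).
Implicit Types (u q : nat -> R).

Definition shift_seq q (k : nat) := if k is k'.+1 then q k' else 0.

Lemma bounded_sums_shift q j : bounded_sums q -> bounded_sums (iter j shift_seq q).
Proof.
move=> hq; elim: j => [|j [B hB]]; first exact: hq.
exists `|B| => -[|n]; first by rewrite big_ord0.
by rewrite big_ord_recl/= add0r (le_trans (hB n))// ler_norm.
Qed.

Lemma iter_shift_seq q j k : iter j shift_seq q k = if (j <= k)%N then q (k - j)%N else 0.
Proof.
by elim: j k => [k|j IHj [|k]] //=; rewrite ?subn0// IHj ltnS subSS.
Qed.

(** The window is the sum of [d] shifted copies of [q]; the zeros that pad the shifts match the
    truncation of [k - d] for small [k]. *)
Lemma bounded_sums_window q d : (forall k, 0 <= q k) -> bounded_sums q ->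
  bounded_sums (fun k => \sum_(k - d <= r < k) q r).
Proof.
move=> q0 hq; elim: d => [|d IHd].
  by exists 0 => n; rewrite big1// => k _; rewrite subn0 big_geq.
apply: (bounded_sums_le (N := 0%N) _ _ (bounded_sumsD IHd (bounded_sums_shift d.+1 hq))) => [k|k _].
  rewrite addr_ge0 ?sumr_ge0// iter_shift_seq; by case: ifP.
rewrite iter_shift_seq; have [dk|kd] := ltnP d k.
  by rewrite subnS big_ltn ?prednK ?subn_gt0 ?ltn_predL ?subn_gt0 ?leq_subr// 1?addrC// (leq_trans (leq_pred _))// leq_subr.
by move: kd; rewrite addr0 subnS -subn_eq0 => /eqP ->.
Qed.

End BoundedDelays.

Lemma summable_of_delay_step (R : realType) (s : nat -> nat) (a : nat -> R) :
  (forall n, (s n <= n)%N) -> finite_delays R s ->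
  (forall n, (0 < n)%N -> 0 < a n) ->
  delay_step_condition s a -> summable_delayed_steps s a.
Proof.
move=> s_le s_finite a_gt0 [|[|[]]]; last 3 first.
- exact: sublinear_summable.
- exact: linear_summable.
- exact: polynomial_summable.
move=> [[D D0 hD] a2 a1].
have a0 k : 0 < a k.+1 by exact: a_gt0.
have partial (b : nat -> R) n : \sum_(1 <= k < n.+1) (b k)%:E = (\sum_(k < n) b k.+1)%:E.
  by rewrite -sumEFin big_add1 big_mkord.
have A2 : bounded_sums (fun k => a k.+1 ^+ 2).
  have h n : ((\sum_(k < n) a k.+1 ^+ 2)%:E <= \sum_(1 <= k <oo) (a k ^+ 2)%:E)%E.
    rewrite -(partial (fun k => a k ^+ 2)); apply: nneseries_lim_ge => k _ _.
    by rewrite lee_fin sqr_ge0.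
  have S0 := h 0%N; rewrite big_ord0 in S0.
  exists (fine (\sum_(1 <= k <oo) (a k ^+ 2)%:E)%E) => n.
  by rewrite -lee_fin fineK// ge0_fin_numE.
split=> //.
- move=> B; apply: contrapT => /forallNP hB.
  have : (\sum_(1 <= n <oo) (a n)%:E <= B%:E)%E.
    apply: lime_le.
      apply: is_cvg_nneseries => n n1 _; rewrite lee_fin ltW//.
      exact: a_gt0.
    exists 1%N => // -[//|n] _ /=; rewrite partial lee_fin ltW//.
    by rewrite ltNge; apply/negP/hB.
  by rewrite a1 leye_eq.
- pose d := (Num.truncn D).+1.
  have sd n : (n - s n <= d)%N.
    rewrite -(ler_nat R); apply: le_trans (delay_ge s_finite n) _.
    by apply: le_trans (hD _) _; apply/ltW/truncnS_gt.
  have hw := bounded_sums_window d (fun k => sqr_ge0 (a k.+1)) A2.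
  have d2 : 0 <= d%:R / 2 :> R by rewrite divr_ge0.
  have h2 : 0 <= 2^-1 :> R by rewrite invr_ge0.
  apply: (bounded_sums_le (N := 0%N) _ _
    (bounded_sumsD (bounded_sumsZ d2 A2) (bounded_sumsZ h2 hw))) => [k|k _].
    by rewrite addr_ge0// mulr_ge0 ?sqr_ge0// sumr_ge0// => *; exact: sqr_ge0.
  (* The range is lengthened from [s k] down to [k - d], and each product [a k.+1 * a r.+1] is split
     by AM-GM. *)
  apply: (@le_trans _ _ (\sum_(k - d <= r < k) (2^-1 * a k.+1 ^+ 2 + 2^-1 * a r.+1 ^+ 2))).
    have dk : (k - d <= s k)%N by rewrite leq_subCl.
    rewrite (big_cat_nat dk (s_le k))/= mulr_sumr ler_wpDl//.
      by apply: sumr_ge0 => r _; rewrite addr_ge0// mulr_ge0// sqr_ge0.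
    apply: ler_sum => r _; have := sqr_ge0 (a k.+1 - a r.+1).
    by rewrite sqrrB; lra.
  rewrite big_split/= sumr_const_nat -mulr_sumr lerD2r -mulrnAl.
  apply: ler_wpM2r; first exact: sqr_ge0.
  rewrite -[_ *+ (k - _)]mulr_natl; apply: ler_wpM2r => //; rewrite ler_nat.
  by rewrite leq_subLR addnC -leq_subLR.
Qed.

(** * The iterates *)

Section Process.
Context (R : realType) (n : nat) (dT dT' : measure_display)
  (T : measurableType dT) (T' : measurableType dT')
  (P : probability T R) (P' : probability T' R)
  (F : 'rV[R]_n -> T -> R) (C L m : R)
  (W : nat -> {RV P' >-> T}) (s : nat -> nat) (a : nat -> R)
  (x0 : 'rV[R]_n) (X : nat -> T' -> 'rV[R]_n).
Hypothesis mF : forall x, measurable_fun setT (F x).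
Hypothesis iF : forall x, P.-integrable setT (EFin \o F x).
Hypothesis dF : forall w (x : 'rV[R]_n), differentiable (F ^~ w) x.
Hypothesis hC : forall x, (\int[P]_w (norm2 (gradF F x w) ^+ 2)%:E <= C%:E)%E.
Hypothesis L0 : 0 <= L.
Hypothesis hL : forall x y,
  norm2 (mean_gradF P F x - mean_gradF P F y) <= L * norm2 (x - y).
Hypothesis W_iid : iid_samples P W.
Hypothesis s_le : forall k, (s k <= k)%N.
Hypothesis a_gt0 : forall k, 0 < a k.+1.
Hypothesis X_dasgd : dasgd F s a (fun k => W k) x0 X.
Hypothesis f_ge : forall x, m <= objective P F x.

Local Notation f := (objective P F).
Local Notation g := (mean_gradF P F).
Local Notation G k w := (gradF F (X (s k) w) (W k w)).
Local Notation M := (1 + C).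
Local Notation past k := (past W k).

Let C0 : 0 <= C. Proof. exact: second_moment_ge0 hC. Qed.
Let a0 k : 0 <= a k.+1. Proof. exact: ltW. Qed.

Let XS k w : X k.+1 w = X k w + (- a k.+1) *: G k w.
Proof. by rewrite (X_dasgd.2 k w) scaleNr. Qed.

(** Strong induction, since [X k.+1] uses the possibly much older [X (s k)]; the only new sample is
    [W k], with [k < j]. *)
Lemma measurable_past_iterate j k : (k <= j)%N ->
  measurable_coord (X k : past j -> 'rV[R]_n).
Proof.
elim/ltn_ind: k => -[|k] IH kj.
  rewrite (_ : X 0%N = fun=> x0); last by apply/funext => w; rewrite X_dasgd.1.
  exact: measurable_coord_cst.
rewrite (_ : X k.+1 = fun w => X k w + (- a k.+1) *: G k w); last first.
  by apply/funext => w; rewrite XS.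
apply: measurable_coordD; first by apply: IH => //; exact: ltnW.
apply: measurable_coordZ; first exact: measurable_cst.
apply: (measurable_gradF mF dF); last exact: measurable_past_sample.
by apply: IH; [rewrite ltnS|exact: leq_trans (s_le k) (ltnW kj)].
Qed.

Lemma measurable_iterate k : measurable_coord (X k).
Proof.
move=> i; have := measurable_past_iterate (leqnn k) i.
by move/measurableT_comp/(_ (@measurable_past_id _ _ _ _ _ _ W k)).
Qed.

Lemma measurable_step_gradient k : measurable_coord (fun w => G k w).
Proof.
exact: (measurable_gradF mF dF (@measurable_iterate (s k)) (@measurable_funPT _ _ _ _ (W k))).
Qed.

(** The identity, seen as a random element of the coarser space [past k]: freezing it freezes [X k]
    and [X (s k)] together. *)
Let p k : {mfun T' >-> past k} := mfun_Sub (mem_set (@measurable_past_id _ _ _ _ _ _ W k)).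

Let p_indep k (A : set (past k)) (B : set T) : measurable A -> measurable B ->
  P' (p k @^-1` A `&` W k @^-1` B) = (P' (p k @^-1` A) * P B)%E.
Proof. by move=> mA mB; exact: (past_independent W_iid mA mB). Qed.

(** With the past frozen, [X (s k)] is a fixed point and [hC] bounds the inner integral. *)
Lemma step_second_moment k : (\int[P']_w (norm2 (G k w) ^+ 2)%:E <= C%:E)%E.
Proof.
pose H (q : past k * T) : \bar R := (norm2 (gradF F (X (s k) q.1) q.2) ^+ 2)%:E.
have mX : measurable_coord (fun q : past k * T => X (s k) q.1).
  move=> i; apply: (measurableT_comp (measurable_past_iterate (s_le k) i)).
  exact: measurable_fst.
have mH : measurable_fun setT H.
  apply/measurable_EFinP/measurable_funX/measurable_norm2.
  by apply: (measurable_gradF mF dF mX); exact: measurable_snd.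
have H0 q : (0 <= H q)%E by rewrite lee_fin sqr_ge0.
have := freezing_ge0 (@p_indep k) mH H0.
rewrite [X in X = _ -> _](_ : _ = \int[P']_w (norm2 (G k w) ^+ 2)%:E)%E// => ->.
apply: (@le_trans _ _ (\int[P']_w C%:E)%E); last first.
  by rewrite integral_cst//= probability_setT mule1.
apply: ge0_le_integral => //.
- by move=> w _; apply: integral_ge0 => t _.
- have := measurable_fun_fubini_tonelli_F H mH H0 (m2 := P).
  by move/measurableT_comp/(_ (@measurable_funPT _ _ _ _ (p k))).
- by move=> w _; exact: (hC (X (s k) w)).
Qed.

Lemma integrable_step_sqr k :
  P'.-integrable setT (EFin \o (fun w => norm2 (G k w) ^+ 2)) /\
  \int[P']_w (norm2 (G k w) ^+ 2) <= C.
Proof.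
apply: ge0_integrableP (step_second_moment k).
  exact/measurable_funX/measurable_norm2/measurable_step_gradient.
by move=> w; exact: sqr_ge0.
Qed.

Lemma integrable_step k :
  P'.-integrable setT (EFin \o (fun w => norm2 (G k w))) /\
  \int[P']_w (norm2 (G k w)) <= M.
Proof.
have [i2 e2] := integrable_step_sqr k.
have i1 : P'.-integrable setT (EFin \o (fun w => norm2 (G k w))).
  apply: square_integrable (step_second_moment k).
  exact/measurable_norm2/measurable_step_gradient.
split=> //; apply: (@le_trans _ _ (\int[P']_w (1 + norm2 (G k w) ^+ 2))).
  apply: le_Rintegral => //; first by apply: integrableDR => //; exact: integrable_cstR.
  by move=> w _; have := sqr_ge0 (norm2 (G k w) - 1); rewrite sqrrB1; have := norm2_ge0 (G k w); lra.
by rewrite RintegralD//; [rewrite Rintegral_cstP lerD2l|exact: integrable_cstR].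
Qed.

Lemma mean_gradF_continuous i : continuous (fun x => g x 0 i).
Proof.
apply: (norm2_lipschitz_continuous (L := L)) => x y; apply: le_trans (hL x y).
rewrite -ler_sqr ?nnegrE ?norm2_ge0// real_normK ?num_real// norm2_sqr.
by rewrite (bigD1 i)//= !mxE lerDl sumr_ge0// => j _; exact: sqr_ge0.
Qed.

Lemma measurable_mean_gradF (dS : measure_display) (S : measurableType dS)
  (Y : S -> 'rV[R]_n) : measurable_coord Y -> measurable_coord (fun w => g (Y w)).
Proof.
by move=> mY i; exact: (measurable_continuous_coord (@mean_gradF_continuous i) mY).
Qed.

Lemma norm2_g x : norm2 (g x) <= M.
Proof.
rewrite -ler_sqr ?nnegrE ?norm2_ge0//; last by rewrite addr_ge0.
apply: le_trans (norm2_mean_gradF mF dF hC x) _.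
by have := sqr_ge0 C; have := C0; rewrite sqrrD; lra.
Qed.

(** Given the past, the stochastic gradient has mean [g (X (s k))], and [g (X k)] is constant. *)
Lemma cross_term k :
  P'.-integrable setT (EFin \o (fun w => dotv (g (X k w)) (G k w))) /\
  \int[P']_w dotv (g (X k w)) (G k w) =
  \int[P']_w dotv (g (X k w)) (g (X (s k) w)).
Proof.
have mX j : (j <= k)%N -> measurable_coord (fun q : past k * T => X j q.1).
  move=> jk i; apply: (measurableT_comp (measurable_past_iterate jk i)).
  exact: measurable_fst.
pose H (q : past k * T) : \bar R :=
  (dotv (g (X k q.1)) (gradF F (X (s k) q.1) q.2))%:E.
have mH : measurable_fun setT H.
  apply/measurable_EFinP; apply: measurable_dotv.
    by apply: measurable_mean_gradF; exact: mX.
  by apply: (measurable_gradF mF dF (mX _ (s_le k))); exact: measurable_snd.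
have iH : P'.-integrable setT (EFin \o (fun w => dotv (g (X k w)) (G k w))).
  have [i1 _] := integrable_step k.
  apply: (integrable_le _ _ (integrableZR M i1)).
    apply: measurable_dotv; last exact: measurable_step_gradient.
    by apply: measurable_mean_gradF; exact: measurable_iterate.
  move=> w; apply: le_trans (norm_dotv _ _) _.
  by rewrite ler_wpM2r ?norm2_ge0// norm2_g.
split=> //; rewrite /Rintegral; congr fine.
have := freezing (@p_indep k) mH iH.
rewrite [X in X = _ -> _](_ : _ = \int[P']_w (dotv (g (X k w)) (G k w))%:E)%E// => ->.
apply: eq_integral => w _; rewrite /H /=.
transitivity (\int[P]_t (dotv (gradF F (X (s k) w) t) (g (X k w)))%:E)%E.
  by apply: eq_integral => t _; rewrite dotvC.
rewrite -EFin_Rintegral; last exact: integrable_dotv mF dF hC _ _.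
by rewrite (Rintegral_dotv mF dF hC) dotvC.
Qed.

Lemma iterate_distance j k w : (j <= k)%N ->
  norm2 (X j w - X k w) <= \sum_(j <= r < k) a r.+1 * norm2 (G r w).
Proof.
move=> jk; rewrite -(subnKC jk); elim: (k - j)%N => [|i IHi].
  by rewrite addn0 subrr norm20 big_geq.
rewrite addnS big_nat_recr ?leq_addr//= XS opprD addrA.
apply: le_trans (ler_norm2D _ _) _; apply: lerD IHi _.
by rewrite norm2N norm2Z normrN ger0_norm.
Qed.

Let y k : R := \int[P']_w (norm2 (g (X k w)) ^+ 2).
Let e k : R := \int[P']_w f (X k w).

Let mgX k : measurable_coord (fun w => g (X k w)).
Proof. by apply: measurable_mean_gradF; exact: measurable_iterate. Qed.

Let iV k : P'.-integrable setT (EFin \o (fun w => norm2 (g (X k w)) ^+ 2)).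
Proof.
apply: (integrable_le _ _ (integrable_cstR P' (M ^+ 2))).
  exact/measurable_funX/measurable_norm2.
by move=> w; rewrite ger0_norm ?sqr_ge0// ler_sqr ?nnegrE ?norm2_ge0 ?norm2_g ?addr_ge0.
Qed.

(** The objective is Lipschitz, so one step changes [f (X k)] by at most
    [M * a k.+1 * norm2 (G k w)], which is integrable. *)
Let ifX k : P'.-integrable setT (EFin \o (fun w => f (X k w))).
Proof.
have cf : continuous f.
  exact: (norm2_lipschitz_continuous (objective_lipschitz mF iF dF hC)).
elim: k => [|k IHk].
  rewrite (_ : (fun w => _) = fun=> f x0); last by apply/funext => w; rewrite X_dasgd.1.
  exact: integrable_cstR.
have [i1 _] := integrable_step k.
have iabs : P'.-integrable setT (EFin \o (fun w => `|f (X k w)|)).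
  have mabs : measurable_fun setT (fun w => `|f (X k w)|).
    apply: (measurableT_comp (f := @Num.norm R R)) => //.
    by apply: (measurable_continuous_coord cf); exact: measurable_iterate.
  move/integrableP: IHk => [_ IHk]; apply/integrableP; split; first exact/measurable_EFinP.
  by under eq_integral => w _ do rewrite /= normr_id.
apply: (integrable_le _ _ (integrableDR iabs (integrableZR (M * a k.+1) i1))).
  by apply: (measurable_continuous_coord cf); exact: measurable_iterate.
move=> w; have := objective_lipschitz mF iF dF hC (X k.+1 w) (X k w).
rewrite XS [X k w + _]addrC addrK norm2Z normrN (ger0_norm (a0 k)) mulrA.
have := ler_normD (f (- a k.+1 *: G k w + X k w) - f (X k w)) (f (X k w)).
by rewrite subrK; lra.
Qed.

(** The descent estimate is applied to the displacement [- a k.+1 *: G k w]. After averaging, the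
    cross term is [y k] up to the mean of [L * M * norm2 (X (s k) w - X k w)], itself at most
    [L * M ^+ 2] times the sum of the intermediate steps. *)
Lemma energy_descent k : a k.+1 * y k <= e k - e k.+1 +
  (L * M ^+ 2 * (a k.+1 * \sum_(s k <= r < k) a r.+1) + L / 2 * C * a k.+1 ^+ 2).
Proof.
have [ix ex] := cross_term k.
have [i2 e2] := integrable_step_sqr k.
pose D w := \sum_(s k <= r < k) a r.+1 * norm2 (G r w).
have [iD eD] : P'.-integrable setT (EFin \o D) /\ \int[P']_w D w <= M * \sum_(s k <= r < k) a r.+1.
  have iG r : P'.-integrable setT (EFin \o (fun w => a r.+1 * norm2 (G r w))).
    by apply: integrableZR; have [] := integrable_step r.
  have [iD eD] := Rintegral_sum (index_iota (s k) k) iG; split; first exact: iD.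
  rewrite eD mulr_sumr; apply: ler_sum => r _; have [i1 e1] := integrable_step r.
  by rewrite RintegralZl// mulrC ler_wpM2r.
have igg : P'.-integrable setT (EFin \o (fun w => dotv (g (X k w)) (g (X (s k) w)))).
  apply: (integrable_le _ _ (integrable_cstR P' (M * M))); first exact: measurable_dotv.
  move=> w; apply: le_trans (norm_dotv _ _) _.
  by rewrite ler_pM ?norm2_ge0 ?norm2_g.
have h1 : y k - L * M ^+ 2 * \sum_(s k <= r < k) a r.+1 <= \int[P']_w dotv (g (X k w)) (G k w).
  rewrite ex.
  apply: (@le_trans _ _ (y k - L * M * \int[P']_w D w)).
    rewrite lerD2l lerN2 expr2 !mulrA -[leRHS]mulrA ler_wpM2l// mulr_ge0//.
    by rewrite addr_ge0.
  rewrite -RintegralZl// -RintegralB//; last exact: integrableZR.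
  apply: le_Rintegral => //.
    exact: (integrableB measurableT (iV k) (integrableZR _ iD)).
  move=> w _; rewrite -dotvv.
  have : `|dotv (g (X (s k) w) - g (X k w)) (g (X k w))| <= L * M * D w.
    apply: le_trans (norm_dotv _ _) _; rewrite mulrAC.
    apply: ler_pM; rewrite ?norm2_ge0 ?norm2_g//.
    by apply: le_trans (hL _ _) _; rewrite ler_wpM2l// iterate_distance.
  rewrite ler_norml dotvDl dotvNl [dotv (g (X (s k) w)) _]dotvC => /andP[h _].
  lra.
have h2 : e k.+1 <= e k - a k.+1 * \int[P']_w dotv (g (X k w)) (G k w) + L / 2 * a k.+1 ^+ 2 * C.
  pose B w := f (X k w) + ((- a k.+1) * dotv (g (X k w)) (G k w) + L / 2 * a k.+1 ^+ 2 * norm2 (G k w) ^+ 2).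
  have iB1 := integrableZR (- a k.+1) ix.
  have iB2 := integrableZR (L / 2 * a k.+1 ^+ 2) i2.
  apply: (@le_trans _ _ (\int[P']_w B w)).
    apply: le_Rintegral => //; first exact: integrableDR (ifX k) (integrableDR iB1 iB2).
    move=> w _; rewrite XS.
    apply: le_trans (objective_descent mF iF dF hC _ _ hL) _.
    rewrite dotvC dotvZl dotvC norm2Z exprMn normrN real_normK ?num_real// /B; lra.
  rewrite /B RintegralD//; last exact: integrableDR iB1 iB2.
  rewrite RintegralD// !RintegralZl// mulNr addrA lerD2l.
  by rewrite ler_wpM2l// mulr_ge0 ?sqr_ge0// divr_ge0.
have h3 := ler_wpM2l (a0 k) h1.
lra.
Qed.

(** A difference of squares: both gradient norms are at most [M], and they differ by at most [L]
    times the length of the step, of mean at most [M * a k.+1]. *)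
Lemma gradient_increment k : `|y k.+1 - y k| <= 2 * L * M ^+ 2 * a k.+1.
Proof.
have [i1 e1] := integrable_step k.
have M0 : 0 <= M by rewrite addr_ge0.
rewrite -RintegralB//; apply: (le_trans (le_normr_Rintegral _ _)) => //.
  exact: (integrableB measurableT (iV _) (iV _)).
apply: (@le_trans _ _ (\int[P']_w (2 * L * M * a k.+1 * norm2 (G k w)))); last first.
  rewrite RintegralZl//.
  have -> : 2 * L * M ^+ 2 * a k.+1 = 2 * L * M * a k.+1 * M by ring.
  by rewrite ler_wpM2l// !mulr_ge0.
have h w : `|norm2 (g (X k.+1 w)) ^+ 2 - norm2 (g (X k w)) ^+ 2| <= 2 * L * M * a k.+1 * norm2 (G k w).
  have hd : norm2 (g (X k.+1 w) - g (X k w)) <= L * (a k.+1 * norm2 (G k w)).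
    apply: le_trans (hL _ _) _.
    by rewrite XS [X k w + _]addrC addrK norm2Z normrN ger0_norm.
  have h1 := ler_norm2D (g (X k.+1 w) - g (X k w)) (g (X k w)).
  have h2 := ler_norm2D (- (g (X k.+1 w) - g (X k w))) (g (X k.+1 w)).
  rewrite subrK in h1; rewrite norm2N opprB subrK in h2.
  have -> : 2 * L * M * a k.+1 * norm2 (G k w) =
    L * (a k.+1 * norm2 (G k w)) * (2 * M) by ring.
  move: hd h1 h2 (norm2_g (X k w)) (norm2_g (X k.+1 w)).
  move: (norm2_ge0 (g (X k w))) (norm2_ge0 (g (X k.+1 w))).
  move: (norm2 (g (X k.+1 w) - g (X k w))) (norm2 (g (X k.+1 w))).
  move: (norm2 (g (X k w))) (L * _) => u t q v u0 v0 qt vq uq uM vM.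
  rewrite subr_sqr normrM; apply: ler_pM => //.
    by rewrite ler_norml; apply/andP; split; lra.
  by rewrite ger0_norm ?addr_ge0//; lra.
have ir : P'.-integrable setT (EFin \o (fun w => 2 * L * M * a k.+1 * norm2 (G k w))).
  exact: integrableZR.
apply: le_Rintegral => //.
apply: (integrable_le _ _ ir) => [|w]; last by rewrite normr_id.
apply: (measurableT_comp (f := @Num.norm R R)) => //.
by apply: measurable_funB; exact/measurable_funX/measurable_norm2.
Qed.

Lemma cvg_second_moment_gradient : summable_delayed_steps s a ->
  (\int[P']_w (norm2 (g (X k w)) ^+ 2)%:E)%E @[k --> \oo] --> 0%E.
Proof.
move=> [h1 h2 h3].
rewrite (_ : (fun k => _) = fun k => (y k)%:E); last first.
  by apply/funext => k; rewrite /y EFin_Rintegral.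
apply: cvg_EFin; first exact: nearW.
apply: (cvg0_of_descent (a := fun k => a k.+1) (e := e) (m := m) a_gt0 _ _ h1 h2 _ energy_descent gradient_increment).
- by move=> k; apply: Rintegral_ge0 => w _; exact: sqr_ge0.
- move=> k; rewrite -(Rintegral_cstP P' m); apply: le_Rintegral => //.
  exact: integrable_cstR.
- apply: bounded_sumsD; apply: bounded_sumsZ => //.
    by rewrite mulr_ge0 ?sqr_ge0.
  by rewrite mulr_ge0// divr_ge0.
Qed.

End Process.

(** * Null sets and the theorem *)

Section NullSets.
Context (R : realType) (d : measure_display) (T : measurableType d)
  (mu : {measure set T -> \bar R}) (N : set T).
Hypotheses (mN : measurable N) (N0 : mu N = 0%E).

Import HBNNSimple.

(* The library's integral of a non-negative function is a supremum over simple
   functions below it, so that no measurability is needed here. *)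
Lemma ge0_integral_le_off_null (u v : T -> \bar R) :
  (forall w, 0 <= u w)%E -> (forall w, 0 <= v w)%E ->
  (forall w, ~ N w -> u w <= v w)%E ->
  (\int[mu]_w u w <= \int[mu]_w v w)%E.
Proof.
move=> u0 v0 uv; rewrite !ge0_integralTE//; apply: ge_ereal_sup => _ [h hu <-].
(* Setting [h] to 0 on [N] keeps its integral and puts it below [v] everywhere. *)
pose h' := proj_nnsfun h (measurableC mN).
have h'E w : h' w = h w * \1_(~` N) w by [].
apply: (@le_trans _ _ (sintegral mu h')); last first.
  apply: ereal_sup_ubound; exists h' => // w.
  rewrite h'E indicE; have [Nw|Nw] := pselect (N w).
    by rewrite memNset ?mulr0// => /(_ Nw).
  by rewrite mem_set// mulr1; apply: le_trans (hu w) (uv w Nw).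
rewrite -!integralT_nnsfun le_eqVlt; apply/orP; left; apply/eqP.
apply: ae_eq_integral => //; [exact/measurable_EFinP|exact/measurable_EFinP|].
exists N; split=> // w; apply: contra_notP => Nw _.
by congr EFin; rewrite h'E indicE mem_set// mulr1.
Qed.

(** Positive and negative parts are compared in both directions, again without measurability, as the
    unmodified gradients and iterates require. *)
Lemma integral_eq_off_null (u v : T -> \bar R) :
  (forall w, ~ N w -> u w = v w) -> (\int[mu]_w u w = \int[mu]_w v w)%E.
Proof.
move=> uv; rewrite integralE [RHS]integralE; congr (_ - _)%E.
  by apply/eqP; rewrite eq_le; apply/andP; split; apply: ge0_integral_le_off_null => // w Nw;
    rewrite !funeposE uv.
by apply/eqP; rewrite eq_le; apply/andP; split; apply: ge0_integral_le_off_null => // w Nw;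
  rewrite !funenegE uv.
Qed.

End NullSets.

(** The recursion reaches back to [s k], so stage [j] of [Y] carries all iterates up to [j]; the
    diagonal [Y k k] is the process. *)
Lemma dasgd_exists (R : realType) (n : nat) (dT dT' : measure_display)
  (T : measurableType dT) (T' : measurableType dT') (F : 'rV[R]_n -> T -> R)
  (s : nat -> nat) (a : nat -> R) (W : nat -> T' -> T) (x0 : 'rV[R]_n) :
  (forall k, (s k <= k)%N) -> exists X, dasgd F s a W x0 X.
Proof.
move=> s_le.
pose Y := fix Y (j : nat) : nat -> T' -> 'rV[R]_n := if j is i.+1 then
    fun k w => if (k <= i)%N then Y i k w
      else Y i i w - a i.+1 *: gradF F (Y i (s i) w) (W i w)
  else fun _ _ => x0.
have YE j k w : (k <= j)%N -> Y j k w = Y k k w.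
  elim: j => [|j IHj]; first by rewrite leqn0 => /eqP ->.
  rewrite leq_eqVlt => /predU1P[->//|kj].
  by rewrite -IHj// /= -ltnS kj.
exists (fun k => Y k k); split => // k w.
by rewrite -(YE k (s k))//= ltnn.
Qed.

Theorem theorem1 (R : realType) (d : nat)
    (dT : measure_display) (T : measurableType dT) (P : probability T R)
    (F : 'rV[R]_d -> T -> R)
    (dT' : measure_display) (T' : measurableType dT') (P' : probability T' R)
    (W : nat -> {RV P' >-> T})
    (s : nat -> nat) (a : nat -> R)
    (x0 : 'rV[R]_d) (X : nat -> T' -> 'rV[R]_d)
    (P_complete : measure_is_complete P)
    (F_measurable : forall x, measurable_fun setT (F x))
    (F_integrable : forall x, P.-integrable setT (EFin \o F x))
    (R1 : ae_differentiable P F)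
    (R2 : bounded_second_moment P F)
    (R3 : lipschitz_mean_gradient P F)
    (W_iid : iid_samples P W)
    (s_le : forall n, (s n <= n)%N)
    (s_finite : finite_delays R s)
    (a_gt0 : forall n, (0 < n)%N -> 0 < a n)
    (D : delay_step_condition s a)
    (X_dasgd : dasgd F s a (fun n => W n) x0 X)
    (f_inf : (-oo < ereal_inf (range (fun x => (objective P F x)%:E)))%E) :
  (fun n => 'E_P'[(fun w => norm2 (gradient (objective P F) (X n w)) ^+ 2)%R]%E)
    @ \oo --> 0%E.
Proof.
have [N [mN PN0 hN]] := R1.
(* Replacing [F] by 0 on the null set [N] makes it differentiable everywhere for every sample and
   leaves the means unchanged. *)
pose F' (x : 'rV[R]_d) w := \1_(~` N) w * F x w.
have F'E w : ~ N w -> F' ^~ w = F ^~ w.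
  by move=> Nw; apply/funext => x; rewrite /F' indicE mem_set// mul1r.
have F'0 w : N w -> F' ^~ w = fun=> 0.
  by move=> Nw; apply/funext => x; rewrite /F' indicE memNset ?mul0r// => /(_ Nw).
have mF x : measurable_fun setT (F' x).
  by apply: measurable_funM => //; apply: measurable_indic; exact: measurableC.
have iF x : P.-integrable setT (EFin \o F' x).
  apply: le_integrable (F_integrable x) => //; first exact/measurable_EFinP.
  move=> w _; rewrite /= lee_fin; have [Nw|Nw] := pselect (N w).
    by rewrite (congr1 (@^~ x) (F'0 w Nw)) normr0.
  by rewrite (congr1 (@^~ x) (F'E w Nw)).
have dF w (x : 'rV[R]_d) : differentiable (F' ^~ w) x.
  have [Nw|Nw] := pselect (N w); first by rewrite F'0//; exact: differentiable_cst.
  by rewrite F'E//; apply: contrapT => h; apply: Nw; apply: hN => /(_ x).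
have gradE x w : ~ N w -> gradF F' x w = gradF F x w.
  by move=> Nw; rewrite /gradF F'E.
have objE : objective P F' = objective P F.
  apply/funext => x; rewrite /objective unlock; congr fine.
  apply: (integral_eq_off_null mN PN0) => w Nw.
  by rewrite (congr1 (@^~ x) (F'E w Nw)).
have meanE : mean_gradF P F' = mean_gradF P F.
  apply/funext => x; apply/rowP => i; rewrite [LHS]mxE [RHS]mxE unlock.
  apply: (congr1 fine).
  by apply: (integral_eq_off_null mN PN0) => w Nw; rewrite gradE.
have [C hC] : exists C : R, forall x,
    (\int[P]_w (norm2 (gradF F' x w) ^+ 2)%:E <= C%:E)%E.
  move: R2; rewrite /bounded_second_moment; set S := ereal_sup _ => Soo.
  have SE x : (\int[P]_w (norm2 (gradF F' x w) ^+ 2)%:E <= S)%E.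
    rewrite (integral_eq_off_null mN PN0
      (v := fun w => (norm2 (gradF F x w) ^+ 2)%:E)); last by move=> w Nw; rewrite gradE.
    by apply: ereal_sup_ubound; exists x => //; rewrite unlock.
  have S0 : (0 <= S)%E.
    by apply: le_trans (SE 0); apply: integral_ge0 => w _; rewrite lee_fin sqr_ge0.
  by exists (fine S) => x; rewrite fineK// ge0_fin_numE.
have [L0 hL0] := R3.
have hL x y : norm2 (mean_gradF P F' x - mean_gradF P F' y) <= `|L0| * norm2 (x - y).
  by rewrite meanE (le_trans (hL0 x y))// ler_wpM2r ?norm2_ge0// ler_norm.
have [m hm] : exists m, forall x, m <= objective P F' x.
  move: f_inf; set I := ereal_inf _ => Ioo.
  have IE x : (I <= (objective P F' x)%:E)%E.
    by rewrite objE; apply: ereal_inf_lbound; exists x.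
  exists (fine I) => x; rewrite -lee_fin fineK//.
  by rewrite fin_numElt Ioo (le_lt_trans (IE 0))// ltry.
(* The same samples drive the process built from [F']; [X] agrees with it unless some sample falls
   in [N]. *)
have [X' hX'] := dasgd_exists F' a (fun k => W k : T' -> T) x0 s_le.
have steps := summable_of_delay_step s_le s_finite a_gt0 D.
have main := @cvg_second_moment_gradient R d dT dT' T T' P P' F' C `|L0| m W s a x0 X'
  mF iF dF hC (normr_ge0 _) hL W_iid s_le (fun k => a_gt0 k.+1 isT) hX' hm steps.
(* Each [W k] has law [P], so it falls in [N] with probability 0, and the countable union of these
   events is null. *)
have [B [mB PB0 hB]] : P'.-negligible (\bigcup_k (W k @^-1` N)).
  apply: negligible_bigcup => k; apply/negligibleP.
    by rewrite -[X in measurable X]setTI; exact: (@measurable_funPT _ _ _ _ (W k)).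
  by have [Wlaw _] := W_iid; rewrite -PN0; exact: Wlaw.
have XE k w : ~ B w -> X k w = X' k w.
  move=> Bw; elim/ltn_ind: k => -[|k] IH; first by rewrite X_dasgd.1 hX'.1.
  have IHk : X k w = X' k w by exact: IH.
  have IHs : X (s k) w = X' (s k) w by apply: IH; rewrite ltnS.
  rewrite (X_dasgd.2 k w) (hX'.2 k w) IHk IHs.
  by rewrite gradE// => NW; apply: Bw; apply: hB; exists k.
rewrite (_ : (fun n => _) =
    fun k => (\int[P']_w (norm2 (mean_gradF P F' (X' k w)) ^+ 2)%:E)%E) //.
apply/funext => k; rewrite unlock; apply: (integral_eq_off_null mB PB0) => w Bw.
by rewrite XE// -objE (gradient_objective mF iF dF hC).
Qed.
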